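(* Consider the control system $$\dot x=f(x,t,p(t/\alpha))+g(x,t,p(t/\alpha))u,\qquad x\in\mathbb{R}^n,\ u\in\mathbb{R}^m, \tag{C}$$ where $\alpha>0$ is a constant, $f:\mathbb{R}^n\times[0,\infty)\times\mathbb{R}^d\to\mathbb{R}^n$ and $g:\mathbb{R}^n\times[0,\infty)\times\mathbb{R}^d\to\mathbb{R}^{n\times m}$ are locally Lipschitz and admit $\alpha_4\in\mathcal{K}_\infty$ such that $|f(x,t,p(t/\alpha))|+|g(x,t,p(t/\alpha))|\le\alpha_4(|x|)$ for all $x\in\mathbb{R}^n$, $t\ge 0$, $\alpha>0$, and $p:\mathbb{R}\to\mathbb{R}^d$ is bounded with a bounded first derivative. Put $\bar p:=\sup\{|p'(r)|:r\in\mathbb{R}\}$ and $\mathcal{R}(p):=\{p(t):t\in\mathbb{R}\}$. Suppose there exist $\alpha_1,\alpha_2\in\mathcal{K}_\infty$, positive constants $c_a,c_b,T$, a continuous function $q:\mathbb{R}^d\to\mathbb{R}$, and a $C^1$ function $V:\mathbb{R}^n\times[0,\infty)\times\mathbb{R}^d\to[0,\infty)$ such that, for all $x\in\mathbb{R}^n$, $t\ge0$ and $\tau\in\mathcal{R}(p)$: 1. $\alpha_1(|x|)\le V(x,t,\tau)\le\alpha_2(|x|)$; 2. $V_t(x,t,\tau)+V_x(x,t,\tau)f(x,t,\tau)\le -q(\tau)V(x,t,\tau)$; 3. $|V_\tau(x,t,\tau)|\le c_aV(x,t,\tau)$; 4. $\int_{t-T}^tq(p(s))\,ds\ge c_b$;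 and such that, for all $x\in\mathbb{R}^n$, $t\ge0$ and $\alpha>0$ (with the same $c_a$ and $\alpha_1$): 5. $|V_x(x,t,p(t/\alpha))|\le c_a\sqrt{\alpha_1(|x|)}$; 6. $|g(x,t,p(t/\alpha))|\le c_a\left(1+\sqrt[4]{\alpha_1(|x|)}\right)$. Then for each constant $\alpha>0$ with $\alpha>4Tc_a\bar p/c_b$, the system (C) is ISS and $$V^\sharp_\alpha(x,t):=\exp\left(\frac{\alpha}{T}\int_{\frac t\alpha-T}^{\frac t\alpha}\int_s^{\frac t\alpha}q(p(l))\,dl\,ds\right)V(x,t,p(t/\alpha))$$ is an ISS Lyapunov function for (C).
   Context: $|\cdot|$ is the Euclidean norm (the same notation is used for the norm of the matrix values of $g$); subscripts on functions denote partial gradients. $C^1$ means continuously differentiable (one-sided at the endpoint $t=0$ of $[0,\infty)$). $\mathcal{K}_\infty$: continuous, strictly increasing, unbounded functions $\rho:[0,\infty)\to[0,\infty)$ with $\rho(0)=0$. $\mathcal{KL}$: continuous functions $\beta:[0,\infty)\times[0,\infty)\to[0,\infty)$ such that $\beta(\cdot,t)\in\mathcal{K}_\infty$ for each $t\ge0$, $\beta(s,\cdot)$ is non-increasing for each $s\ge0$, and $\beta(s,t)\to0$ as $t\to+\infty$ for each $s\ge 0$. A continuous function $\rho:[0,\infty)\to[0,\infty)$ is positive definite if it is zero only at zero. $\mathcal{U}$ is the set of measurable essentially bounded functions $\mathbf{u}:[0,\infty)\to\mathbb{R}^m$, with essential supremum norm $|\cdot|_\infty$. For a control affine system $\dot x=h(x,t)+J(x,t)u$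 and $t_o\ge0$, $x_o\in\mathbb{R}^n$, $\mathbf{u}\in\mathcal{U}$, $\phi(\cdot;t_o,x_o,\mathbf{u})$ denotes the unique maximal solution of $\dot x(t)=h(x(t),t)+J(x(t),t)\mathbf{u}(t)$ for a.e. $t$, $x(t_o)=x_o$. Standing assumption: for (C) (every $\alpha>0$) all these solutions are defined on all of $[t_o,\infty)$. - The system is ISS (input-to-state stable) if there exist $\beta\in\mathcal{KL}$ and $\gamma\in\mathcal{K}_\infty$ with $|\phi(t;t_o,x_o,\mathbf{u})|\le\beta(|x_o|,t-t_o)+\gamma(|\mathbf{u}|_\infty)$ for all $t\ge t_o$, $t_o\ge0$, $x_o\in\mathbb{R}^n$, $\mathbf{u}\in\mathcal{U}$. - An ISS Lyapunov function for it is a $C^1$ function $W:\mathbb{R}^n\times[0,\infty)\to[0,\infty)$ for which there exist $\alpha_1,\alpha_2,\chi\in\mathcal{K}_\infty$ and a positive definite $\alpha_3$ such that for all $x\in\mathbb{R}^n$, $t\ge0$, $u\in\mathbb{R}^m$: $\alpha_1(|x|)\le W(x,t)\le\alpha_2(|x|)$, and $|u|\le\chi(|x|)$ implies $W_t(x,t)+W_x(x,t)[h(x,t)+J(x,t)u]\le-\alpha_3(|x|)$.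
   Formalization: The first derivative of p is additionally assumed continuous (p is C^1); without it V^sharp need not be C^1, e.g. f=-x, g=0, V=e^tau x^2, q=2 with p' bounded but discontinuous, so the claim that it is an ISS Lyapunov function fails. *)

(* Defs.v *)
(* R^k is 'cV[R]_k.  Functions of a time t in [0, +oo[ are total functions on R
   of which only the values at t >= 0 matter. *)
From HB Require Import structures.
From mathcomp Require Import all_boot all_order all_algebra.
From mathcomp Require Import all_classical all_reals all_analysis.
From mathcomp Require Import measurable_realfun ess_sup_inf.

Set Implicit Arguments.
Unset Strict Implicit.
Unset Printing Implicit Defensive.

Import Order.TTheory GRing.Theory Num.Theory.
Import numFieldNormedType.Exports.

Local Open Scope classical_set_scope.
Local Open Scope ring_scope.

(* The library norm `|x| on matrices is the max norm, hence these two. *)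
Definition enorm (R : realType) (k : nat) (x : 'cV[R]_k) : R :=
  Num.sqrt (\sum_i x i 0 ^+ 2).

(* The norm on matrices induced by [enorm]. *)
Definition opnorm (R : realType) (k l : nat) (A : 'M[R]_(k, l)) : R :=
  sup [set enorm (A *m v) | v in [set v : 'cV[R]_l | enorm v <= 1]].

Definition dotv (R : realType) (k : nat) (a b : 'cV[R]_k) : R :=
  \sum_i a i 0 * b i 0.

Definition Kinf (R : realType) (rho : R -> R) : Prop :=
  [/\ {within `[0, +oo[, continuous rho},
      {in `[0, +oo[ &, {homo rho : a b / a < b}},
      rho 0 = 0 &
      forall M : R, exists2 s, 0 <= s & M < rho s].

Definition KL (R : realType) (beta : R -> R -> R) : Prop :=
  [/\ {within [set z : R * R | 0 <= z.1 /\ 0 <= z.2],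
         continuous (fun z : R * R => beta z.1 z.2)},
      forall t, 0 <= t -> Kinf (beta^~ t),
      forall s, 0 <= s -> {in `[0, +oo[ &, {homo beta s : a b / a <= b >-> b <= a}} &
      forall s, 0 <= s -> beta s t @[t --> +oo] --> (0 : R)].

Definition posdef (R : realType) (rho : R -> R) : Prop :=
  [/\ {within `[0, +oo[, continuous rho},
      forall s, 0 <= s -> 0 <= rho s &
      forall s, 0 <= s -> (rho s = 0 <-> s = 0)].

Definition grad (R : realType) (k : nat) (F : 'cV[R]_k -> R) (x : 'cV[R]_k) :
    'cV[R]_k :=
  \col_i 'D_(delta_mx i 0) F x.

Definition has_partials (R : realType) (k : nat) (F : 'cV[R]_k -> R)
    (x : 'cV[R]_k) : Prop :=
  forall i, derivable F x (delta_mx i 0).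

(* Difference quotients within [0, +oo[: the limit is the usual derivative for
   t > 0 and the right derivative for t = 0. *)
Definition tderivable (R : realType) (F : R -> R) (t : R) : Prop :=
  cvg ((F s - F t) / (s - t) @[s --> within [set s | 0 <= s] t^']).

Definition tderive (R : realType) (F : R -> R) (t : R) : R :=
  lim ((F s - F t) / (s - t) @[s --> within [set s | 0 <= s] t^']).

Definition C1_xt (R : realType) (n : nat) (W : 'cV[R]_n -> R -> R) : Prop :=
  let D := [set z : 'cV[R]_n * R | 0 <= z.2] in
  [/\ forall x t, 0 <= t ->
        has_partials (W^~ t) x /\ tderivable (W x) t,
      {within D, continuous (fun z : 'cV[R]_n * R => W z.1 z.2)},
      {within D, continuous (fun z : 'cV[R]_n * R => grad (W^~ z.2) z.1)} &
      {within D, continuous (fun z : 'cV[R]_n * R => tderive (W z.1) z.2)}].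

Definition dom_xtau (R : realType) (n d : nat) : set ('cV[R]_n * R * 'cV[R]_d) :=
  [set z | 0 <= z.1.2].

Definition V_x (R : realType) (n d : nat) (V : 'cV[R]_n -> R -> 'cV[R]_d -> R)
    (x : 'cV[R]_n) (t : R) (tau : 'cV[R]_d) : 'cV[R]_n :=
  grad (fun y => V y t tau) x.

Definition V_t (R : realType) (n d : nat) (V : 'cV[R]_n -> R -> 'cV[R]_d -> R)
    (x : 'cV[R]_n) (t : R) (tau : 'cV[R]_d) : R :=
  tderive (fun s => V x s tau) t.

Definition V_tau (R : realType) (n d : nat) (V : 'cV[R]_n -> R -> 'cV[R]_d -> R)
    (x : 'cV[R]_n) (t : R) (tau : 'cV[R]_d) : 'cV[R]_d :=
  grad (V x t) tau.

Definition C1_xttau (R : realType) (n d : nat)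
    (V : 'cV[R]_n -> R -> 'cV[R]_d -> R) : Prop :=
  [/\ forall x t tau, 0 <= t ->
        [/\ has_partials (fun y => V y t tau) x,
            tderivable (fun s => V x s tau) t &
            has_partials (V x t) tau],
      {within @dom_xtau R n d, continuous (fun z => V z.1.1 z.1.2 z.2)},
      {within @dom_xtau R n d, continuous (fun z => V_x V z.1.1 z.1.2 z.2)},
      {within @dom_xtau R n d, continuous (fun z => V_t V z.1.1 z.1.2 z.2)} &
      {within @dom_xtau R n d, continuous (fun z => V_tau V z.1.1 z.1.2 z.2)}].

Definition abs_continuous (R : realType) (n : nat) (a b : R)
    (phi : R -> 'cV[R]_n) : Prop :=
  forall e : R, 0 < e -> exists2 del : R, 0 < del &
    forall (k : nat) (s t : 'I_k -> R),
      (forall i, a <= s i /\ s i <= t i /\ t i <= b) ->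
      trivIset setT (fun i => `]s i, t i[%classic) ->
      \sum_i (t i - s i) < del ->
      \sum_i enorm (phi (t i) - phi (s i)) < e.

(* Essential supremum over [0, +oo[ (the extension by 0 does not affect it, as
   norms are nonnegative). *)
Definition input_norm (R : realType) (m : nat) (u : R -> 'cV[R]_m) : \bar R :=
  ess_sup (@lebesgue_measure R) ((fun t => (enorm (u t))%:E) \_ `[0, +oo[).

(* [completed_algebra_gen lebesgue_measure] is the sigma-algebra of the Lebesgue
   measurable sets; [measurable] sets of R are only the Borel sets. *)
Definition input (R : realType) (m : nat) (u : R -> 'cV[R]_m) : Prop :=
  (forall i (B : set R), measurable B ->
     completed_algebra_gen (@lebesgue_measure R)
       ((`[0, +oo[%classic : set R) `&` (fun t => u t i 0) @^-1` B)) /\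
  (input_norm u < +oo)%E.

(* Caratheodory solution of x' = h(x,t) + J(x,t) u(t), x(t0) = x0, on the whole
   of [t0, +oo[; the values of phi before t0 are irrelevant. *)
Definition solution (R : realType) (n m : nat)
    (h : 'cV[R]_n -> R -> 'cV[R]_n) (J : 'cV[R]_n -> R -> 'M[R]_(n, m))
    (t0 : R) (x0 : 'cV[R]_n) (u : R -> 'cV[R]_m) (phi : R -> 'cV[R]_n) : Prop :=
  [/\ phi t0 = x0,
      forall b, t0 < b -> abs_continuous t0 b phi &
      \forall t \ae (@lebesgue_measure R), t0 < t ->
        is_derive t (1 : R) phi (h (phi t) t + J (phi t) t *m u t)].

Definition forward_complete (R : realType) (n m : nat)
    (h : 'cV[R]_n -> R -> 'cV[R]_n) (J : 'cV[R]_n -> R -> 'M[R]_(n, m)) : Prop :=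
  forall (t0 : R) (x0 : 'cV[R]_n) (u : R -> 'cV[R]_m),
    0 <= t0 -> input u -> exists phi, solution h J t0 x0 u phi.

(* For locally Lipschitz h and J the solution through (t0, x0) is unique on
   [t0, +oo[, so quantifying over all solutions is quantifying over the flow. *)
Definition ISS (R : realType) (n m : nat)
    (h : 'cV[R]_n -> R -> 'cV[R]_n) (J : 'cV[R]_n -> R -> 'M[R]_(n, m)) : Prop :=
  forward_complete h J /\
  exists (beta : R -> R -> R) (gamma : R -> R),
    [/\ KL beta, Kinf gamma &
        forall (t0 : R) (x0 : 'cV[R]_n) (u : R -> 'cV[R]_m) (phi : R -> 'cV[R]_n),
          0 <= t0 -> input u -> solution h J t0 x0 u phi ->
          forall t, t0 <= t ->
            enorm (phi t) <= beta (enorm x0) (t - t0) + gamma (fine (input_norm u))].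

Definition ISS_Lyapunov (R : realType) (n m : nat)
    (h : 'cV[R]_n -> R -> 'cV[R]_n) (J : 'cV[R]_n -> R -> 'M[R]_(n, m))
    (W : 'cV[R]_n -> R -> R) : Prop :=
  [/\ C1_xt W,
      forall x t, 0 <= t -> 0 <= W x t &
      exists alpha1 alpha2 chi alpha3 : R -> R,
        [/\ Kinf alpha1, Kinf alpha2, Kinf chi, posdef alpha3 &
            forall (x : 'cV[R]_n) (t : R) (u : 'cV[R]_m), 0 <= t ->
              alpha1 (enorm x) <= W x t <= alpha2 (enorm x) /\
              (enorm u <= chi (enorm x) ->
               tderive (W x) t + dotv (grad (W^~ t) x) (h x t + J x t *m u)
                 <= - alpha3 (enorm x))]].

Definition Vsharp (R : realType) (n d : nat) (alpha T : R) (q : 'cV[R]_d -> R)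
    (p : R -> 'cV[R]_d) (V : 'cV[R]_n -> R -> 'cV[R]_d -> R)
    (x : 'cV[R]_n) (t : R) : R :=
  expR (alpha / T *
        \int[lebesgue_measure]_(s in `[t / alpha - T, t / alpha])
          \int[lebesgue_measure]_(l in `[s, t / alpha]) q (p l))
  * V x t (p (t / alpha)).

(* Main.v *)
Require Import Defs.
From HB Require Import structures.
From mathcomp Require Import all_boot all_order all_algebra.
From mathcomp Require Import all_classical all_reals all_analysis.
From mathcomp Require Import measurable_realfun ess_sup_inf.
From mathcomp Require Import ring lra.

Set Implicit Arguments.
Unset Strict Implicit.
Unset Printing Implicit Defensive.

Import Order.TTheory GRing.Theory Num.Theory.
Import numFieldNormedType.Exports.

Local Open Scope classical_set_scope.
Local Open Scope ring_scope.

(* Along the uncontrolled flow, [V x t (p (t / alpha))] changes at relative rate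
   at most [- q (p (t / alpha)) + c_a * pbar / alpha].  The logarithm of the
   exponential factor of [Vsharp] has derivative
   [q (p r) - T^-1 * \int_(r - T)^r q (p l) dl] at [r = t / alpha], which replaces
   [q] by its average, at least [c_b / T].  The slow variation costs at most
   [c_b / (4 T)], and so does the input when [|u| <= chi |x|] with
   [chi = c y^2 / (1 + y)], [y = alpha1^(1/4)], [c = c_b / (4 T c_a^2)]; hence
   [Vsharp] decays at rate [c_b / (2 T)].

   A solution is merely absolutely continuous, so the decay of [Vsharp] along it
   is only known almost everywhere.  It is integrated by covering [[a, b]] with
   small intervals: around a point of differentiability the increment is at most
   [e] times the length, and around the others the intervals stay in an open set
   of small measure, where absolute continuity controls the total increment. *)

(** * Comparison functions *)

(** The [C1] conditions speak of partial derivatives, continuous up to [t = 0], where the time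
    derivative is one-sided. They supply neither a total derivative nor an open domain, so a strict
    form of differentiability is derived from the continuity of the partials; it yields both the
    chain rule and the local Lipschitz bound on which the covering argument relies. The function [q]
    may take both signs, but [p] has bounded range, so [q (p r)] is bounded and the exponential
    factor lies between two positive constants. This is how [Vsharp] inherits comparison bounds from
    [V]. The form of [chi] is dictated by the growth conditions: [|V_x| <= c_a y^2] and
    [|g| <= c_a (1 + y)], so an input of size [c y^2 / (1 + y)] contributes at most [c_a^2 c y^4],
    which is [c_b / (4 T)] times [alpha1 |x|] and is dominated by the same multiple of [V]. *)

Lemma within_continuous_comp (T U S : topologicalType) (A : set U) (B : set T)
    (f : U -> S) (g : T -> U) :
  {within A, continuous f} -> {within B, continuous g} ->
  (forall x, B x -> A (g x)) -> {within B, continuous (f \o g)}.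
Proof.
move=> /subspace_continuousP cf /subspace_continuousP cg BA.
apply/subspace_continuousP => x Bx.
have gA : g y @[y --> within B (nbhs x)] --> within A (nbhs (g x)).
  move=> P AP; have /= := cg x Bx _ AP.
  rewrite !nbhs_simpl /within /=.
  by apply: filterS => y yAP By; apply: yAP => //; exact: BA.
exact: cvg_comp gA (cf _ (BA _ Bx)).
Qed.

Lemma within_continuous_pair (T U S : topologicalType) (A : set T)
    (f : T -> U) (g : T -> S) :
  {within A, continuous f} -> {within A, continuous g} ->
  {within A, continuous (fun x => (f x, g x))}.
Proof.
move=> /subspace_continuousP cf /subspace_continuousP cg.
apply/subspace_continuousP => x Ax.
exact: (cvg_pair (cf x Ax) (cg x Ax)).
Qed.

Section comparison_functions.
Variable R : realType.
Implicit Types (rho sigma : R -> R) (a b s : R).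

(** Precomposing with the absolute value extends [rho] evenly to all of [R], which replaces
    continuity within a half-line by plain continuity; [continuous_Kinf] is the way back. *)
Lemma Kinf_continuous rho : Kinf rho -> continuous (fun x : R => rho `|x|).
Proof.
case=> cr _ _ _; apply/continuous_subspace_setT.
apply: (@within_continuous_comp R R R `[0, +oo[%classic setT rho
  (fun x : R => `|x| : R)) => //.
  by apply: continuous_subspaceT => x; exact: norm_continuous.
by move=> x _; rewrite /= in_itv/= normr_ge0.
Qed.

Lemma Kinf_ltr rho a b : Kinf rho -> 0 <= a -> a < b -> rho a < rho b.
Proof.
move=> [_ inc _ _] a0 ab; apply: inc => //; rewrite in_itv/= andbT//.
exact: le_trans a0 (ltW ab).
Qed.

Lemma Kinf_ler rho a b : Kinf rho -> 0 <= a -> a <= b -> rho a <= rho b.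
Proof.
move=> Kr a0; rewrite le_eqVlt => /predU1P[->//|ab].
exact/ltW/Kinf_ltr.
Qed.

Lemma Kinf_ge0 rho s : Kinf rho -> 0 <= s -> 0 <= rho s.
Proof. by move=> Kr s0; case: (Kr) => _ _ <- _; exact: Kinf_ler. Qed.

Lemma Kinf_gt0 rho s : Kinf rho -> 0 < s -> 0 < rho s.
Proof. by move=> Kr s0; case: (Kr) => _ _ <- _; exact: Kinf_ltr. Qed.

Lemma continuous_Kinf rho : continuous (fun x : R => rho `|x|) ->
  (forall a b, 0 <= a -> a < b -> rho a < rho b) -> rho 0 = 0 ->
  (forall M, exists2 s, 0 <= s & M < rho s) -> Kinf rho.
Proof.
move=> cr inc r0 unb; split => //.
  have : {within `[0, +oo[, continuous (fun x : R => rho `|x|)}.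
    exact: continuous_subspaceT.
  apply: subspace_eq_continuous => x; rewrite in_setE/= in_itv/= andbT => x0.
  by rewrite /from_subspace/= ger0_norm.
by move=> a b; rewrite !in_itv/= !andbT => a0 _; exact: inc.
Qed.

Lemma Kinf_comp rho sigma : Kinf rho -> Kinf sigma -> Kinf (rho \o sigma).
Proof.
move=> Kr Ks; apply: continuous_Kinf => /=.
- have -> : (fun x : R => rho (sigma `|x|)) =
    (fun x => rho `|x|) \o (fun x => sigma `|x|).
    by apply/funext => x /=; rewrite (ger0_norm (Kinf_ge0 Ks _)).
  by move=> x; apply: continuous_comp; exact: Kinf_continuous.
- by move=> a b a0 ab; apply/Kinf_ltr => //; [exact: Kinf_ge0|exact: Kinf_ltr].
- by case: Ks => _ _ -> _; case: Kr.
- move=> M; case: (Kr) => _ _ _ /(_ M)[s s0 Ms].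
  case: (Ks) => _ _ _ /(_ s)[t t0 st]; exists t => //.
  exact/(lt_trans Ms)/Kinf_ltr.
Qed.

Lemma KinfZ (c : R) rho : 0 < c -> Kinf rho -> Kinf (fun s => c * rho s).
Proof.
move=> c0 Kr; apply: continuous_Kinf.
- by move=> x; apply: cvgM; [exact: cvg_cst|exact: Kinf_continuous].
- by move=> a b a0 ab; rewrite ltr_pM2l//; exact: Kinf_ltr.
- by case: Kr => _ _ -> _; rewrite mulr0.
- move=> M; case: (Kr) => _ _ _ /(_ (M / c))[s s0 Ms]; exists s => //.
  by rewrite mulrC -ltr_pdivrMr.
Qed.

Lemma Kinf_surj rho s : Kinf rho -> 0 <= s -> exists2 t, 0 <= t & rho t = s.
Proof.
move=> Kr s0; case: (Kr) => _ _ r0 /(_ s)[t t0 st].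
have cr : {within `[0, t], continuous (fun x : R => rho `|x|)}.
  exact/continuous_subspaceT/Kinf_continuous.
have [|c] := IVT (v := s) t0 cr.
  rewrite normr0 r0 (ger0_norm t0) ge_min le_max s0 (ltW st) orbT//.
by rewrite in_itv/= => /andP[c0 _]; rewrite ger0_norm// => <-; exists c.
Qed.

Lemma Kinf_lt_inv rho a b : Kinf rho -> 0 <= a -> 0 <= b ->
  rho a < rho b -> a < b.
Proof.
move=> Kr a0 b0 rab; rewrite ltNge; apply/negP => ba.
by have := Kinf_ler Kr b0 ba; rewrite leNgt rab.
Qed.

(** The inverse is picked pointwise by choice. Its continuity comes from monotonicity alone: [sigma]
    stays within [e] of [y] as long as [|z|] lies between [rho (y - e)] and [rho (y + e)]. *)
Lemma Kinf_inverse rho : Kinf rho -> exists2 sigma, Kinf sigma &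
  forall s, 0 <= s -> sigma (rho s) = s /\ rho (sigma s) = s.
Proof.
move=> Kr.
have /choice[sigma sP] : forall s, exists t, 0 <= s -> 0 <= t /\ rho t = s.
  move=> s; have [s0|s0] := leP 0 s; last by exists 0.
  by have [t t0 rt] := Kinf_surj Kr s0; exists t.
have s_ge0 s : 0 <= s -> 0 <= sigma s by move=> /sP[].
have rs s : 0 <= s -> rho (sigma s) = s by move=> /sP[].
have s_lt a b : 0 <= a -> a < b -> sigma a < sigma b.
  move=> a0 ab; have b0 := le_trans a0 (ltW ab).
  apply: (Kinf_lt_inv Kr); [exact: s_ge0|exact: s_ge0|by rewrite !rs].
have sr s : 0 <= s -> sigma (rho s) = s.
  move=> s0; have rs0 := Kinf_ge0 Kr s0.
  apply/eqP; rewrite eq_le !leNgt; apply/andP; split; apply/negP => h.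
    by have := Kinf_ltr Kr s0 h; rewrite rs// ltxx.
  by have := Kinf_ltr Kr (s_ge0 _ rs0) h; rewrite rs// ltxx.
have s_le a b : 0 <= a -> a <= b -> sigma a <= sigma b.
  by move=> a0; rewrite le_eqVlt => /predU1P[->//|ab]; exact/ltW/s_lt.
exists sigma; last (by move=> s s0; rewrite sr ?rs); apply: continuous_Kinf => //.
- move=> x; apply/cvgrPdist_le => /= e e0.
  set y := sigma `|x|; have y0 : 0 <= y by exact: s_ge0.
  have ry : rho y = `|x| by exact: rs.
  have : \forall z \near x, `|z| < rho (y + e).
    have : `|x| < rho (y + e) by rewrite -ry; apply: Kinf_ltr => //; lra.
    by have := @norm_continuous _ _ x; move=> /cvgr_lt h /h.
  (* For [e > y] the argument [y - e] is negative, where [rho] is not controlled; there the lower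
     bound is just [sigma >= 0]. *)
  have : \forall z \near x, e <= y -> rho (y - e) < `|z|.
    have [ey|ye] := leP e y; last by near=> z.
    have : rho (y - e) < `|x| by rewrite -ry; apply: Kinf_ltr => //; lra.
    have := @norm_continuous _ _ x; move=> /cvgr_gt h /h.
    by apply: filterS.
  apply: filterS2 => z lo hi.
  have zu : sigma `|z| <= y + e.
    by rewrite -[leRHS]sr; [apply: s_le => //; exact: ltW|lra].
  have zl : y - e <= sigma `|z|.
    have [ey|ye] := leP e y; last by have := s_ge0 `|z| (normr_ge0 _); lra.
    rewrite -[leLHS]sr; last lra.
    by apply: s_le; [apply: Kinf_ge0 => //; lra|exact/ltW/lo].
  by rewrite ler_distlC; apply/andP; split; lra.
- by case: Kr => _ _ r0 _; rewrite -[in LHS]r0 sr.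
- move=> M; exists (rho (`|M| + 1)); first by apply: Kinf_ge0 => //; lra.
  by rewrite sr; [have := ler_norm M; lra|have := normr_ge0 M; lra].
Unshelve. all: by end_near. Qed.

Lemma Kinf_posdef rho : Kinf rho -> posdef rho.
Proof.
move=> Kr; case: (Kr) => cr _ r0 _; split => // s s0; first exact: Kinf_ge0.
split=> [|->//]; move: s0; rewrite le_eqVlt => /predU1P[->//|s0].
by have := Kinf_gt0 Kr s0 => /[swap] ->; rewrite ltxx.
Qed.

Lemma Kinf_sqrt : Kinf (@Num.sqrt R).
Proof.
apply: continuous_Kinf.
- move=> x; apply: (@continuous_comp _ _ _ (fun x : R => `|x|) Num.sqrt).
    exact: norm_continuous.
  exact: sqrt_continuous.
- by move=> a b a0 ab; rewrite ltr_sqrt//; exact: le_lt_trans a0 ab.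
- by rewrite sqrtr0.
- move=> M; exists ((`|M| + 1) ^+ 2); first exact: sqr_ge0.
  rewrite sqrtr_sqr ger0_norm; have := ler_norm M; have := normr_ge0 M; lra.
Qed.

Lemma Kinf_sqr_div : Kinf (fun s : R => s ^+ 2 / (1 + s)).
Proof.
apply: continuous_Kinf.
- move=> x; apply: cvgM.
    by apply: (@cvgM R R (nbhs x) _ (fun x => `|x|) (fun x => `|x|)); exact: norm_continuous.
  apply: cvgV; first by have := normr_ge0 x; lra.
  by apply: cvgD; [exact: cvg_cst|exact: norm_continuous].
- move=> a b a0 ab; rewrite ltr_pdivrMr; last lra.
  rewrite mulrAC ltr_pdivlMr; last lra.
  rewrite -subr_gt0; set D := (X in 0 < X).
  have -> : D = (b - a) * (a + b + a * b) by rewrite /D; ring.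
  have b0 : 0 < b by exact: le_lt_trans ab.
  by rewrite mulr_gt0 ?subr_gt0// ltr_wpDr ?mulr_ge0 ?ltr_wpDl// ltW.
- by rewrite expr0n mul0r.
- move=> M; exists (`|M| + 2); first by have := normr_ge0 M; lra.
  have M0 := normr_ge0 M; have := ler_norm M.
  rewrite ltr_pdivlMr; last lra.
  nra.
Qed.

(** The shape of the transient bound obtained from an exponentially decaying Lyapunov function:
    [sigma] is its upper bound, [rho] the inverse of its lower bound, and [lam] the rate. *)
Lemma KL_exp rho sigma (lam : R) : 0 < lam -> Kinf rho -> Kinf sigma ->
  KL (fun s t => rho (expR (- lam * t) * sigma s)).
Proof.
move=> lam0 Kr Ks.
have arg_ge0 s t : 0 <= s -> 0 <= expR (- lam * t) * sigma s.
  by move=> s0; rewrite mulr_ge0 ?expR_ge0 ?Kinf_ge0.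
split.
- have : {within [set z : R * R | 0 <= z.1 /\ 0 <= z.2], continuous
      (fun z => rho `|expR (- lam * z.2) * sigma `|z.1| |)}.
    apply: continuous_subspaceT => z.
    apply: (@continuous_comp _ _ _
      (fun z : R * R => expR (- lam * z.2) * sigma `|z.1|)
      (fun x => rho `|x|)); last exact: Kinf_continuous.
    apply: cvgM.
      apply: (@continuous_comp _ _ _ (fun z : R * R => - lam * z.2) expR).
        by apply: cvgM; [exact: cvg_cst|exact: cvg_snd].
      exact: continuous_expR.
    apply: (@continuous_comp _ _ _ fst (fun x => sigma `|x|)).
      exact: cvg_fst.
    exact: Kinf_continuous.
  apply: subspace_eq_continuous => -[s t]; rewrite in_setE/= => -[s0 t0].
  by rewrite /from_subspace/= (ger0_norm s0) ger0_norm// arg_ge0.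
- move=> t _; apply: (@Kinf_comp rho (fun s => expR (- lam * t) * sigma s)) => //.
  by apply: KinfZ => //; exact: expR_gt0.
- move=> s s0 a b _ _ ab; apply: Kinf_ler => //; first exact: arg_ge0.
  by rewrite ler_wpM2r ?Kinf_ge0// ler_expR !mulNr lerN2 ler_pM2l.
- move=> s s0.
  have -> : (fun t => rho (expR (- lam * t) * sigma s)) =
      (fun x => rho `|x|) \o (fun t => expR (- lam * t) * sigma s).
    by apply/funext => t /=; rewrite ger0_norm// arg_ge0.
  have elam : expR (- lam * t) @[t --> +oo] --> (0 : R).
    under eq_fun do rewrite mulNr.
    apply: (@cvg_comp _ _ _ (fun t => lam * t) (fun x => expR (- x)));
      last exact: cvgr_expR.
    by apply: gt0_cvgMry; [exact: lam0|exact: cvg_id].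
  have h : expR (- lam * t) * sigma s @[t --> +oo] --> (0 : R).
    by rewrite -(mul0r (sigma s)); apply: cvgMr_tmp.
  have h0 : rho `|x| @[x --> (0 : R)] --> (0 : R).
    have := Kinf_continuous Kr (x := 0).
    by rewrite /continuous_at normr0; case: (Kr) => _ _ -> _.
  exact: cvg_comp h h0.
Qed.

End comparison_functions.

(** * Euclidean and operator norms *)

Section euclidean_norm.
Variable R : realType.

Lemma enorm_ge0 k (x : 'cV[R]_k) : 0 <= enorm x.
Proof. exact: sqrtr_ge0. Qed.

Lemma sum_sqr_ge0 k (x : 'cV[R]_k) : 0 <= \sum_i x i 0 ^+ 2.
Proof. by apply: sumr_ge0 => i _; exact: sqr_ge0. Qed.

Lemma sqr_enorm k (x : 'cV[R]_k) : enorm x ^+ 2 = \sum_i x i 0 ^+ 2.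
Proof. by rewrite sqr_sqrtr// sum_sqr_ge0. Qed.

Lemma coord_le_enorm k (x : 'cV[R]_k) i : `|x i 0| <= enorm x.
Proof.
rewrite -sqrtr_sqr ler_sqrt ?sum_sqr_ge0// (bigD1 i)//= lerDl.
by apply: sumr_ge0 => j _; exact: sqr_ge0.
Qed.

(** The sum norm is the natural error measure when one coordinate is moved at a time, as in
    [increment_le]. *)
Definition norm1 k (x : 'cV[R]_k) : R := \sum_i `|x i 0|.

Lemma enorm_eq0 k (x : 'cV[R]_k) : enorm x = 0 -> x = 0.
Proof.
move=> x0; apply/colP => i; rewrite mxE; apply/eqP.
by rewrite -normr_le0 -x0 coord_le_enorm.
Qed.

Lemma enormZ k (c : R) (x : 'cV[R]_k) : enorm (c *: x) = `|c| * enorm x.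
Proof.
rewrite /enorm -sqrtr_sqr -sqrtrM ?sqr_ge0// mulr_sumr.
by congr Num.sqrt; apply: eq_bigr => i _; rewrite mxE exprMn.
Qed.

Lemma sum_coord_le_enorm k (x : 'cV[R]_k) : \sum_i `|x i 0| <= k%:R * enorm x.
Proof.
rewrite (le_trans (ler_sum _ (fun i _ => coord_le_enorm x i)))//.
by rewrite sumr_const card_ord mulr_natl.
Qed.

Lemma enorm_le_sum_coord k (x : 'cV[R]_k) : enorm x <= \sum_i `|x i 0|.
Proof.
have S0 : 0 <= \sum_i `|x i 0| by exact: sumr_ge0.
rewrite -(ger0_norm S0) -sqrtr_sqr ler_sqrt ?sqr_ge0// expr2 mulr_suml.
apply: ler_sum => i _; rewrite -[x i 0 ^+ 2]ger0_norm ?sqr_ge0//.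
rewrite normrX expr2 ler_wpM2l//.
by rewrite (bigD1 i)//= lerDl sumr_ge0.
Qed.

Lemma norm_coord_le k l (A : 'M[R]_(k, l)) i j : `|A i j| <= `|A|.
Proof.
by rewrite [leRHS]/Num.norm/= mx_normrE; exact: (le_bigmax _ _ (i, j)).
Qed.

Lemma norm_le_coord k l (A : 'M[R]_(k, l)) (M : R) : 0 <= M ->
  (forall i j, `|A i j| <= M) -> `|A| <= M.
Proof.
move=> M0 AM; rewrite [leLHS]/Num.norm/= mx_normrE.
by apply: bigmax_le => // -[i j] _; exact: AM.
Qed.

Lemma dotvDr k (a b c : 'cV[R]_k) : dotv a (b + c) = dotv a b + dotv a c.
Proof.
by rewrite -big_split/=; apply: eq_bigr => i _; rewrite mxE mulrDr.
Qed.

Lemma dotvZl k (c : R) (a b : 'cV[R]_k) : dotv (c *: a) b = c * dotv a b.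
Proof. by rewrite mulr_sumr; apply: eq_bigr => i _; rewrite mxE mulrA. Qed.

Lemma dotvZr k (c : R) (a b : 'cV[R]_k) : dotv a (c *: b) = c * dotv a b.
Proof. by rewrite mulr_sumr; apply: eq_bigr => i _; rewrite mxE mulrCA. Qed.

Lemma dotv_le_coord k (a b : 'cV[R]_k) (M : R) :
  (forall i, `|a i 0| <= M) -> `|dotv a b| <= M * \sum_i `|b i 0|.
Proof.
move=> aM; rewrite (le_trans (ler_norm_sum _ _ _))// mulr_sumr.
by apply: ler_sum => i _; rewrite normrM ler_wpM2r.
Qed.

Lemma dotv_le k (a b : 'cV[R]_k) : dotv a b <= enorm a * enorm b.
Proof.
have [/enorm_eq0 ->|a0] := eqVneq (enorm a) 0.
  rewrite /dotv big1 ?mulr_ge0 ?enorm_ge0// => i _.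
  by rewrite mxE mul0r.
have [/enorm_eq0 ->|b0] := eqVneq (enorm b) 0.
  rewrite /dotv big1 ?mulr_ge0 ?enorm_ge0// => i _.
  by rewrite mxE mulr0.
set A := enorm a in a0 *; set B := enorm b in b0 *.
have A0 : 0 < A by rewrite lt0r a0 enorm_ge0.
have B0 : 0 < B by rewrite lt0r b0 enorm_ge0.
(* Cauchy-Schwarz through [2 a b <= (B / A) a^2 + (A / B) b^2], whose weights make the sum over the
   coordinates exactly [A * B]. *)
have -> : A * B = \sum_i (B / A / 2 * a i 0 ^+ 2 + A / B / 2 * b i 0 ^+ 2).
  by rewrite big_split/= -!mulr_sumr -!sqr_enorm -/A -/B; field; apply/andP.
apply: ler_sum => i _; rewrite -subr_ge0.
have -> : B / A / 2 * a i 0 ^+ 2 + A / B / 2 * b i 0 ^+ 2 - a i 0 * b i 0 =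
    (B * a i 0 - A * b i 0) ^+ 2 / (2 * A * B) by field; apply/andP.
by rewrite divr_ge0 ?sqr_ge0// ltW// !mulr_gt0.
Qed.

Lemma enorm_mulmx_le k l (A : 'M[R]_(k, l)) (v : 'cV[R]_l) :
  enorm (A *m v) <= opnorm A * enorm v.
Proof.
have [v0|v0] := eqVneq (enorm v) 0.
  by rewrite v0 mulr0 (enorm_eq0 v0) mulmx0 -[X in enorm X](scale0r 0) enormZ
    normr0 mul0r.
have v0' : 0 < enorm v by rewrite lt0r v0 enorm_ge0.
rewrite -ler_pdivrMr// mulrC -[_^-1]ger0_norm ?invr_ge0 ?enorm_ge0//.
rewrite -enormZ scalemxAr; apply: ub_le_sup; last first.
  exists ((enorm v)^-1 *: v) => //=.
  by rewrite enormZ ger0_norm ?invr_ge0 ?enorm_ge0// mulVf.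
(* A supremum dominates its members only if the set is bounded above; on the unit ball the entries
   of [A] give a bound. *)
exists (\sum_(i < k) \sum_(j < l) `|A i j|) => _ [w /= w1 <-].
rewrite (le_trans (enorm_le_sum_coord _))//; apply: ler_sum => i _.
rewrite mxE (le_trans (ler_norm_sum _ _ _))//; apply: ler_sum => j _.
by rewrite normrM ler_piMr// (le_trans (coord_le_enorm _ _)).
Qed.

Lemma mx_continuous (T : topologicalType) k l (F : T -> 'M[R]_(k, l)) (x : T) :
  (forall i j, {for x, continuous (fun t => F t i j)}) -> {for x, continuous F}.
Proof.
move=> cF; apply/cvgrPdist_le => /= e e0.
have : \forall t \near x, forall ij : 'I_k * 'I_l, `|F x ij.1 ij.2 - F t ij.1 ij.2| <= e.
  apply: filter_forall => -[i j] /=.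
  by have /cvgrPdist_le := cF i j; exact.
apply: filterS => t tP; apply: norm_le_coord; first exact: ltW.
by move=> i j; rewrite !mxE; exact: (tP (i, j)).
Qed.

Lemma dotv_continuous (T : topologicalType) k (a b : T -> 'cV[R]_k) (x : T) :
  {for x, continuous a} -> {for x, continuous b} ->
  {for x, continuous (fun z => dotv (a z) (b z))}.
Proof.
move=> ca cb; apply: cvg_big => // [|i _].
  by move=> y; exact: add_continuous.
apply: cvgM.
  exact: (@cvg_comp _ _ _ a (fun M : 'cV[R]_k => M i 0) _ _ _ ca
    (@coord_continuous _ _ _ i 0 (a x))).
exact: (@cvg_comp _ _ _ b (fun M : 'cV[R]_k => M i 0) _ _ _ cb
    (@coord_continuous _ _ _ i 0 (b x))).
Qed.

(** Serves to bound [q] on the bounded range of [p]. The Euclidean ball lies in a product of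
    segments, which is compact; compactness and the extreme value theorem are taken for row vectors,
    hence the transposes. *)
Lemma continuous_bounded_cV k (F : 'cV[R]_k -> R) (M : R) : continuous F ->
  exists B, forall x, enorm x <= M -> `|F x| <= B.
Proof.
move=> cF; pose A := [set v : 'rV[R]_k | forall i, v ord0 i \in `[- M, M]].
have cA : compact A.
  apply: (@rV_compact _ _ (fun=> `[- M, M]%classic)) => _.
  exact: segment_compact.
have cG : continuous (fun v : 'rV[R]_k => `|F v^T|).
  move=> v; apply: continuous_comp; last exact: norm_continuous.
  apply: continuous_comp; last exact: cF.
  apply: mx_continuous => i j.
  rewrite (_ : (fun _ => _) = (fun v : 'rV_k => v j i)).
    exact: coord_continuous.
  by apply/funext => w; rewrite mxE.
have [M0|M0] := ltP M 0.
  by exists 0 => x h; have := le_lt_trans (le_trans (enorm_ge0 x) h) M0; rewrite ltxx.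
have A0 : A !=set0.
  by exists 0 => i; rewrite mxE in_itv/= M0 andbT oppr_le0.
have [c _ cmax] := EVT_max_rV A0 cA (continuous_subspaceT cG).
exists `|F c^T| => x xM; rewrite -[x in F x]trmxK; apply: cmax.
rewrite in_setE => i; rewrite mxE in_itv/= -ler_norml.
exact: le_trans (coord_le_enorm _ _) xM.
Qed.

End euclidean_norm.

(** * Strict differentiability on a closed half-space *)

Section one_sided_derivative.
Variable R : realType.
Implicit Types (F : R -> R) (t l : R).

(** Derivative at [t] within [[0, +oo[] as a linear approximation. Without a quotient, [s = t] needs
    no exception, error terms simply add up, and the endpoint [t = 0] is treated like any other
    time. *)
Definition tder F t l := forall e : R, 0 < e ->
  nbhs t [set s : R | 0 <= s -> `|F s - F t - l * (s - t)| <= e * `|s - t|].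

(** Limits are unique only along a proper filter; points to the right of [t] belong to the
    half-line, even at [t = 0]. *)
Lemma within_ge0_dnbhs_proper t : 0 <= t ->
  ProperFilter (within [set s : R | 0 <= s] t^').
Proof.
move=> t0; split; last exact: within_filter.
rewrite /within /= => h.
have : \forall s \near t^'+, False.
  have : \forall s \near t^'+, t < s by exact: nbhs_right_gt.
  have : \forall s \near t^'+, s != t -> 0 <= s -> False by exact: cvg_within.
  apply: filterS2 => s + ts; apply; first by rewrite gt_eqF.
  exact: le_trans (ltW ts).
by move=> /filter_ex[].
Qed.

Lemma tder_tderive F t l : 0 <= t -> tder F t l ->
  tderivable F t /\ tderive F t = l.
Proof.
move=> t0 dF.
have Fl : (F s - F t) / (s - t) @[s --> within [set s | 0 <= s] t^'] --> l.
  apply/cvgrPdist_le => e e0.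
  have := dF _ e0; rewrite !near_withinE; apply: filterS => s sP st s0.
  have st0 : 0 < `|s - t| by rewrite normr_gt0 subr_eq0.
  rewrite distrC -(ler_pM2r st0) -normrM (le_trans _ (sP s0))//.
  by rewrite mulrBl divfK// subr_eq0.
have PF := within_ge0_dnbhs_proper t0.
by split; [apply/cvg_ex; exists l|exact: cvg_lim].
Qed.

Lemma tderivable_tder F t : 0 <= t -> tderivable F t -> tder F t (tderive F t).
Proof.
move=> t0 dF e e0.
have /cvgrPdist_le/(_ _ e0) : (F s - F t) / (s - t)
    @[s --> within [set s | 0 <= s] t^'] --> tderive F t by [].
rewrite !near_withinE.
apply: filterS => s sP s0; have [->|st] := eqVneq s t.
  by rewrite !subrr mulr0 subr0 normr0 mulr0.
have st0 : 0 < `|s - t| by rewrite normr_gt0 subr_eq0.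
rewrite -ler_pdivrMr// -normfV -normrM (le_trans _ (sP st s0))// distrC.
by rewrite mulrBl mulfK// subr_eq0.
Qed.

(** For [t > 0] the constraint [0 <= s] holds near [t], so the approximation is two-sided. The slope
    function of Caratheodory's criterion is built explicitly. *)
Lemma tder_is_derive F t l : 0 < t -> tder F t l -> is_derive t 1 F l.
Proof.
move=> t0 dF; apply/is_derive1_caratheodory.
exists (fun z => if z == t then l else (F z - F t) / (z - t)).
rewrite eqxx; split => // [z|].
  by have [->|zt] := eqVneq z t; rewrite ?subrr ?mulr0// divfK// subr_eq0.
apply/cvgrPdist_le => /= e e0; rewrite eqxx.
have [z0 dz] : (\forall z \near t, 0 <= z) /\
  \forall s \near t, 0 <= s -> `|F s - F t - l * (s - t)| <= e * `|s - t|.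
  by split; [exact: (@cvgr_ge _ _ (nbhs t) _ id t)|exact: dF].
apply: filterS2 z0 dz => z z0 /(_ z0) dz.
have [zt|zt] := eqVneq z t; first by rewrite subrr normr0 ltW.
have zt0 : 0 < `|z - t| by rewrite normr_gt0 subr_eq0.
rewrite distrC -(ler_pM2r zt0) -normrM (le_trans _ dz)//.
by rewrite mulrBl divfK// subr_eq0.
Qed.

Lemma is_derive_tder F t l : is_derive t 1 F l -> tder F t l.
Proof.
move=> /is_derive1_caratheodory[g [Fg cg gt]] e e0.
have /cvgrPdist_le/(_ _ e0) := cg; apply: filterS => s gs _.
by rewrite Fg -mulrBl normrM ler_wpM2r// -gt distrC.
Qed.

Lemma tder_continuous F t l : tder F t l ->
  forall e : R, 0 < e -> nbhs t [set s : R | 0 <= s -> `|F s - F t| <= e].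
Proof.
move=> dF e e0; pose k := `|l| + 1.
have k0 : 0 < k by rewrite ltr_wpDl.
have ek : 0 < e / k by rewrite divr_gt0.
have /cvgrPdist_le/(_ _ ek) : s @[s --> t] --> t by exact: cvg_id.
apply: filterS2 (dF _ ltr01) => s sP ts s0.
have := sP s0; rewrite mul1r => {}sP.
have -> : F s - F t = (F s - F t - l * (s - t)) + l * (s - t) by ring.
rewrite (le_trans (ler_normD _ _))// normrM.
rewrite (@le_trans _ _ (k * `|s - t|))//.
  by rewrite /k mulrDl mul1r addrC lerD2l.
by rewrite mulrC -ler_pdivlMr// distrC.
Qed.

Lemma eq_tder (F G : R -> R) (t l : R) : 0 <= t ->
  (forall s, 0 <= s -> F s = G s) -> tder F t l -> tder G t l.
Proof.
move=> t0 FG dF e e0; apply: filterS (dF e e0) => s sP s0.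
by rewrite -!FG//; exact: sP.
Qed.

(** Increments are taken between arbitrary nearby points, whose coordinates come in either order;
    exchanging the ends changes the sign of both sides. *)
Lemma MVT_unordered (h dh : R -> R) (a b : R) :
  (forall x, Num.min a b < x < Num.max a b -> is_derive x 1 h (dh x)) ->
  {within `[Num.min a b, Num.max a b], continuous h} ->
  exists2 c, Num.min a b <= c <= Num.max a b & h b - h a = dh c * (b - a).
Proof.
have [ab|ba] := leP a b => dF cF.
  have [c] := MVT_segment ab (fun x xab => dF x xab) cF.
  by rewrite in_itv/= => cab E; exists c.
have [c] := MVT_segment (ltW ba) (fun x xab => dF x xab) cF.
rewrite in_itv/= => cab E; exists c => //.
by rewrite -opprB E -mulrN opprB.
Qed.

(** An end of the segment may be [0], where only a one-sided derivative exists; at the ends the mean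
    value theorem asks for continuity alone. *)
Lemma tderive_MVT F (a b : R) : 0 <= a -> 0 <= b ->
  (forall t, 0 <= t -> tderivable F t) ->
  exists2 c, Num.min a b <= c <= Num.max a b & F b - F a = tderive F c * (b - a).
Proof.
move=> a0 b0 dF; have m0 : 0 <= Num.min a b by rewrite le_min a0.
apply: MVT_unordered.
  move=> x /andP[mx _]; have x0 := le_lt_trans m0 mx.
  by apply: tder_is_derive => //; apply: tderivable_tder (ltW x0) (dF _ (ltW x0)).
apply/subspace_continuousP => x /=; rewrite in_itv/= => /andP[mx _].
apply/cvgrPdist_le => e e0; rewrite near_withinE.
have x0 := le_trans m0 mx.
have := tder_continuous (tderivable_tder x0 (dF _ x0)) e0.
apply: filterS => s sP; rewrite /= in_itv/= => /andP[ms _].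
by rewrite distrC; apply: sP; exact: le_trans ms.
Qed.

Lemma tder_mul F G t k l : tder F t k -> tder G t l ->
  tder (fun s => F s * G s) t (k * G t + F t * l).
Proof.
move=> dF dG e e0.
pose c := `|G t| + `|F t| + `|k| + 1.
have c0 : 0 < c by rewrite ltr_wpDl// !addr_ge0.
have ec : 0 < e / c by rewrite divr_gt0.
have := dF _ ec; have := dG _ ec.
have := tder_continuous dG ec; have := tder_continuous dG ltr01.
move=> H1 H2 H3 H4.
apply: filterS (filterI (filterI H1 H2) (filterI H3 H4)).
move=> s [[+ +] [+ +]] s0 => /(_ s0) h1 /(_ s0) h2 /(_ s0) h3 /(_ s0) h4.
have -> : F s * G s - F t * G t - (k * G t + F t * l) * (s - t) =
   (F s - F t - k * (s - t)) * (G s - G t) + (F s - F t - k * (s - t)) * G t +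
   k * (s - t) * (G s - G t) + F t * (G s - G t - l * (s - t)) by ring.
have -> : e * `|s - t| = e / c * `|s - t| * 1 + e / c * `|s - t| * `|G t| +
   `|k| * `|s - t| * (e / c) + `|F t| * (e / c * `|s - t|).
  have eE : e = e / c * c by rewrite divfK// gt_eqF.
  by rewrite {1}eE; set q := e / c; rewrite /c; ring.
apply: le_trans (ler_normD _ _) _; apply: lerD; last first.
  by rewrite normrM ler_wpM2l.
apply: le_trans (ler_normD _ _) _; apply: lerD; last first.
  by rewrite !normrM ler_wpM2l// mulr_ge0.
apply: le_trans (ler_normD _ _) _; apply: lerD; rewrite normrM.
  by apply: ler_pM.
by rewrite ler_wpM2r.
Qed.

End one_sided_derivative.

Section strict_differentiability.
Variable R : realType.

Lemma is_derive_line k (G : 'cV[R]_k -> R) (x e : 'cV[R]_k) (r : R) :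
  derivable G (x + r *: e) e ->
  is_derive r 1 (fun s => G (x + s *: e)) ('D_e G (x + r *: e)).
Proof.
move=> dG.
have E : (fun h : R => h^-1 *: ((fun s => G (x + s *: e)) (h *: 1 + r) -
      (fun s => G (x + s *: e)) r)) =
    (fun h => h^-1 *: (G (h *: e + (x + r *: e)) - G (x + r *: e))).
  apply/funext => h; congr (_ *: (G _ - _)).
  by rewrite /= [h *: 1]mulr1 scalerDl addrCA.
apply: DeriveDef; first by rewrite /derivable E.
by rewrite /derive E.
Qed.

Lemma ball_between (a x y x0 D : R) : Num.min x y <= a <= Num.max x y ->
  `|x - x0| < D -> `|y - x0| < D -> `|a - x0| < D.
Proof.
rewrite !ltr_norml => + /andP[x1 x2] /andP[y1 y2].
by have [xy|yx] := leP x y => /andP[a1 a2]; apply/andP; split; lra.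
Qed.

(** The coordinates of [x] are replaced by those of [y] one at a time, with the mean value theorem
    on each edge. The path does not leave the ball because the norm here is the max norm, whose
    balls are boxes. *)
Lemma increment_le k (G : 'cV[R]_k -> R) (x0 c : 'cV[R]_k) (D e : R) :
  (forall y, `|y - x0| < D ->
     has_partials G y /\ forall i, `|grad G y i 0 - c i 0| <= e) ->
  forall x y, `|x - x0| < D -> `|y - x0| < D ->
  `|G y - G x - dotv c (y - x)| <= e * \sum_i `|(y - x) i 0|.
Proof.
move=> dG x y xD yD.
pose z (j : nat) : 'cV[R]_k := \col_i (if (i < j)%N then y i 0 else x i 0).
have D0 : 0 < D by exact: le_lt_trans xD.
have coordD (w : 'cV[R]_k) i : `|w - x0| < D -> `|w i 0 - x0 i 0| < D.
  by apply: le_lt_trans; rewrite (_ : w i 0 - x0 i 0 = (w - x0) i 0) ?norm_coord_le// !mxE.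
have G0 : G x = G (z 0%N) by congr G; apply/colP => i; rewrite mxE.
have Gk : G y = G (z k) by congr G; apply/colP => i; rewrite mxE ltn_ord.
have -> : G y - G x - dotv c (y - x) =
    \sum_(i < k) (G (z i.+1) - G (z i) - c i 0 * (y i 0 - x i 0)).
  rewrite sumrB -(big_mkord xpredT (fun i => G (z i.+1) - G (z i))).
  rewrite telescope_sumr// -Gk -G0; congr (_ - _).
  by apply: eq_bigr => i _; rewrite !mxE.
rewrite (le_trans (ler_norm_sum _ _ _))// mulr_sumr; apply: ler_sum => j _.
(* The edge from [z j] to [z j.+1] is the line [p + r *: ej], with [r] between [x j 0] and
   [y j 0]. *)
pose p : 'cV[R]_k := \col_i (if i == j then 0 else z j i 0).
pose ej : 'cV[R]_k := delta_mx j 0.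
have zj : z j = p + x j 0 *: ej.
  apply/colP => i; rewrite !mxE eqxx andbT; have [->|ij] := eqVneq i j.
    by rewrite ltnn mulr1 add0r.
  by rewrite mulr0 addr0.
have zj1 : z j.+1 = p + y j 0 *: ej.
  apply/colP => i; rewrite !mxE eqxx andbT ltnS leq_eqVlt val_eqE.
  by have [->|ij] := eqVneq i j; rewrite ?mulr1 ?add0r// mulr0 addr0.
have pD r : Num.min (x j 0) (y j 0) <= r <= Num.max (x j 0) (y j 0) ->
    `|p + r *: ej - x0| < D.
  move=> rxy.
  rewrite [ltLHS]/Num.norm/= mx_normrE; apply/bigmax_ltP; split => // -[i l] _.
  rewrite [l]ord1/= !mxE eqxx andbT; have [->|ij] := eqVneq i j.
    by rewrite mulr1 add0r; apply: (ball_between rxy); exact: coordD.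
  by rewrite mulr0 addr0; case: ifP => _; exact: coordD.
have dline r : Num.min (x j 0) (y j 0) <= r <= Num.max (x j 0) (y j 0) ->
    is_derive r 1 (fun s => G (p + s *: ej)) (grad G (p + r *: ej) j 0).
  by move=> /pD /dG[dGp _]; rewrite mxE; apply: is_derive_line; exact: dGp.
have [r rxy||r rxy E] := @MVT_unordered R (fun s => G (p + s *: ej))
    (fun r => grad G (p + r *: ej) j 0) (x j 0) (y j 0).
- by case/andP: rxy => /ltW mr /ltW rm; apply: dline; rewrite mr.
- apply/subspace_continuousP => r /=; rewrite in_itv/= => /dline dl.
  apply: cvg_within_filter; apply: differentiable_continuous.
  by apply/derivable1_diffP; case: dl.
have -> : (y - x) j 0 = y j 0 - x j 0 by rewrite !mxE.
rewrite zj zj1 E -mulrBl normrM ler_wpM2r//.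
by have [_] := dG _ (pD _ rxy); exact.
Qed.

Variables n d : nat.

Lemma within_ball_le (W : normedModType R) (F : 'cV[R]_n * R * 'cV[R]_d -> W)
    (x0 : 'cV[R]_n) (t0 : R) (tau0 : 'cV[R]_d) (e : R) :
  {within @dom_xtau R n d, continuous F} -> 0 <= t0 -> 0 < e ->
  exists2 D, 0 < D & forall x t tau, `|x - x0| < D -> `|t - t0| < D ->
    `|tau - tau0| < D -> 0 <= t -> `|F (x, t, tau) - F (x0, t0, tau0)| <= e.
Proof.
move=> /subspace_continuousP cF t0_ge0 e0.
have /cvgrPdist_le/(_ _ e0) := cF (x0, t0, tau0) t0_ge0.
rewrite near_withinE => /nbhs_ballP[D /= D0 DP]; exists D => // x t tau xD tD tauD t_ge0.
rewrite distrC; apply: (DP (x, t, tau)) => //.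
by split => /=; [split => /=|]; rewrite -ball_normE /ball_/= distrC.
Qed.

Variable V : 'cV[R]_n -> R -> 'cV[R]_d -> R.
Hypothesis V_C1 : C1_xttau V.

(** Strict differentiability: both points vary near the base point and one linear map serves all
    pairs. It follows from the continuity of the three partials by moving [x], then [t], then [tau].
    Fixing one point at the base gives the chain rule; leaving both free gives a local Lipschitz
    bound. *)
Lemma C1_strict (x0 : 'cV[R]_n) (t0 : R) (tau0 : 'cV[R]_d) (e : R) :
  0 <= t0 -> 0 < e -> exists2 D, 0 < D &
  forall x x' t t' tau tau', `|x - x0| < D -> `|x' - x0| < D ->
    `|t - t0| < D -> `|t' - t0| < D -> `|tau - tau0| < D -> `|tau' - tau0| < D ->
    0 <= t -> 0 <= t' ->
  `|V x' t' tau' - V x t tau - (dotv (V_x V x0 t0 tau0) (x' - x) +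
      V_t V x0 t0 tau0 * (t' - t) + dotv (V_tau V x0 t0 tau0) (tau' - tau))|
  <= e * (norm1 (x' - x) + `|t' - t| + norm1 (tau' - tau)).
Proof.
move=> t0_ge0 e0; case: V_C1 => dV _ cx ct ctau.
have [D1 D1_gt0 cxP] := within_ball_le x0 tau0 cx t0_ge0 e0.
have [D2 D2_gt0 ctP] := within_ball_le x0 tau0 ct t0_ge0 e0.
have [D3 D3_gt0 ctauP] := within_ball_le x0 tau0 ctau t0_ge0 e0.
exists (Num.min D1 (Num.min D2 D3)); first by rewrite !lt_min D1_gt0 D2_gt0.
move=> x x' t t' tau tau'; rewrite !lt_min.
move=> /and3P[x1 x2 x3] /and3P[x1' x2' x3'] /and3P[t1 t2 t3] /and3P[t1' t2' t3'].
move=> /and3P[u1 u2 u3] /and3P[u1' u2' u3'] t_ge0 t'_ge0.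
have Ix : `|V x' t tau - V x t tau - dotv (V_x V x0 t0 tau0) (x' - x)|
    <= e * norm1 (x' - x).
  apply: (@increment_le _ (fun y => V y t tau) x0 _ D1) => // y yD.
  split=> [|i]; first by have [] := dV y t tau t_ge0.
  have := cxP y t tau yD t1 u1 t_ge0; apply: le_trans.
  by have := norm_coord_le (V_x V y t tau - V_x V x0 t0 tau0) i 0;
    rewrite mxE [X in _ + X]mxE.
have Itau : `|V x' t' tau' - V x' t' tau - dotv (V_tau V x0 t0 tau0) (tau' - tau)|
    <= e * norm1 (tau' - tau).
  apply: (@increment_le _ (fun y => V x' t' y) tau0 _ D3) => // y yD.
  split=> [|i]; first by have [] := dV x' t' y t'_ge0.
  have := ctauP x' t' y x3' t3' yD t'_ge0; apply: le_trans.
  by have := norm_coord_le (V_tau V x' t' y - V_tau V x0 t0 tau0) i 0;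
    rewrite mxE [X in _ + X]mxE.
have It : `|V x' t' tau - V x' t tau - V_t V x0 t0 tau0 * (t' - t)|
    <= e * `|t' - t|.
  have [|r rtt E] := @tderive_MVT R (fun s => V x' s tau) t t' t_ge0 t'_ge0.
    by move=> s s0; have [] := dV x' s tau s0.
  have r0 : 0 <= r.
    by case/andP: rtt => + _; apply: le_trans; rewrite le_min t_ge0.
  rewrite E -mulrBl normrM ler_wpM2r//.
  exact: ctP x2' (ball_between rtt t2 t2') u2 r0.
have -> : V x' t' tau' - V x t tau - (dotv (V_x V x0 t0 tau0) (x' - x) +
      V_t V x0 t0 tau0 * (t' - t) + dotv (V_tau V x0 t0 tau0) (tau' - tau)) =
  (V x' t tau - V x t tau - dotv (V_x V x0 t0 tau0) (x' - x)) +
  (V x' t' tau - V x' t tau - V_t V x0 t0 tau0 * (t' - t)) +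
  (V x' t' tau' - V x' t' tau - dotv (V_tau V x0 t0 tau0) (tau' - tau)) by ring.
rewrite [leRHS]mulrDr (mulrDr e (norm1 _)).
apply: le_trans (ler_normD _ _) _; apply: lerD => //.
by apply: le_trans (ler_normD _ _) _; apply: lerD.
Qed.

Lemma C1_chain_rule (xi : R -> 'cV[R]_n) (pi : R -> 'cV[R]_d) (t : R)
    (v : 'cV[R]_n) (w : 'cV[R]_d) : 0 <= t ->
  (forall i, tder (fun s => xi s i 0) t (v i 0)) ->
  (forall i, tder (fun s => pi s i 0) t (w i 0)) ->
  tder (fun s => V (xi s) s (pi s)) t
    (dotv (V_x V (xi t) t (pi t)) v + V_t V (xi t) t (pi t) +
     dotv (V_tau V (xi t) t (pi t)) w).
Proof.
move=> t0 dxi dpi e e0.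
pose c (k : nat) (a b : 'cV[R]_k) := \sum_i (`|a i 0| + `|b i 0| + 1).
have c_ge0 k (a b : 'cV[R]_k) : 0 <= c k a b.
  by apply: sumr_ge0 => i _; rewrite !addr_ge0.
set gx := V_x V (xi t) t (pi t); set gt := V_t V (xi t) t (pi t).
set gu := V_tau V (xi t) t (pi t).
(* [C] gathers what multiplies [h * |s - t|] in the final error, the [1] coming from the time
   increment; [h <= 1] bounds the increment of coordinate [i] by [(1 + |b i 0|) * |s - t|]. *)
pose C := c n gx v + c d gu w + 1.
have C0 : 0 < C by rewrite ltr_wpDl// addr_ge0.
pose h := Num.min 1 (e / (2 * C)).
have h0 : 0 < h by rewrite lt_min ltr01 divr_gt0// mulr_gt0.
have [D D0 DP] := C1_strict (xi t) (pi t) t0 h0.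
have close k (y : R -> 'cV[R]_k) (b : 'cV[R]_k) : (forall i, tder (fun s => y s i 0) t (b i 0)) ->
    nbhs t [set s : R | 0 <= s -> `|y s - y t| < D].
  move=> dy; have D2 : 0 < D / 2 by rewrite divr_gt0.
  have : nbhs t [set s : R | forall i, 0 <= s -> `|y s i 0 - y t i 0| <= D / 2].
    exact: filter_forall (fun i => tder_continuous (dy i) D2).
  apply: filterS => s sP s0; rewrite (@le_lt_trans _ _ (D / 2)) ?gtr_pMr ?invf_lt1 ?ltr1n//.
  by apply: norm_le_coord => [|i j]; [exact: ltW|rewrite [j]ord1 !mxE sP].
have lin k (y : R -> 'cV[R]_k) (b : 'cV[R]_k) : (forall i, tder (fun s => y s i 0) t (b i 0)) ->
    nbhs t [set s : R | forall i, 0 <= s ->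
      `|y s i 0 - y t i 0 - b i 0 * (s - t)| <= h * `|s - t|].
  by move=> dy; exact: filter_forall (fun i => dy i _ h0).
have sD : nbhs t [set s : R | `|s - t| < D].
  have /cvgrPdist_lt/(_ _ D0) : s @[s --> t] --> t by exact: cvg_id.
  by apply: filterS => s; rewrite distrC.
apply: filterS (filterI (filterI (close _ _ _ dxi) (close _ _ _ dpi))
  (filterI sD (filterI (lin _ _ _ dxi) (lin _ _ _ dpi)))).
move=> s [[+ +] [sD' [lx lu]]] s0 => /(_ s0) xD /(_ s0) uD.
have coord k (y : R -> 'cV[R]_k) (a b : 'cV[R]_k) : (forall i, 0 <= s ->
    `|y s i 0 - y t i 0 - b i 0 * (s - t)| <= h * `|s - t|) ->
    `|dotv a (y s - y t) - dotv a b * (s - t)| + h * norm1 (y s - y t)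
      <= h * c k a b * `|s - t|.
  move=> ly; rewrite /norm1 /c !mulr_sumr !mulr_suml -sumrB.
  rewrite -lerBrDr -sumrB (le_trans (ler_norm_sum _ _ _))//; apply: ler_sum => i _.
  rewrite !mxE lerBrDr.
  have -> : a i 0 * (y s i 0 - y t i 0) - a i 0 * b i 0 * (s - t) =
     a i 0 * (y s i 0 - y t i 0 - b i 0 * (s - t)) by ring.
  rewrite normrM; have {}ly := ly i s0.
  have yb : `|y s i 0 - y t i 0| <= (1 + `|b i 0|) * `|s - t|.
    have -> : y s i 0 - y t i 0 = (y s i 0 - y t i 0 - b i 0 * (s - t)) +
      b i 0 * (s - t) by ring.
    rewrite (le_trans (ler_normD _ _))// normrM mulrDl lerD2r (le_trans ly)//.
    by rewrite ler_wpM2r// ge_min lexx.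
  have := ler_wpM2l (normr_ge0 (a i 0)) ly.
  have := ler_wpM2l (ltW h0) yb.
  by lra.
have := DP (xi t) (xi s) t s (pi t) (pi s).
rewrite !subrr !normr0 => /(_ D0 xD D0 sD' D0 uD t0 s0) {}DP.
have {}lx := coord _ _ gx _ lx; have {}lu := coord _ _ gu _ lu.
have -> : V (xi s) s (pi s) - V (xi t) t (pi t) - (dotv gx v + gt + dotv gu w) * (s - t) =
  (V (xi s) s (pi s) - V (xi t) t (pi t) - (dotv gx (xi s - xi t) +
      gt * (s - t) + dotv gu (pi s - pi t))) +
  (dotv gx (xi s - xi t) - dotv gx v * (s - t)) +
  (dotv gu (pi s - pi t) - dotv gu w * (s - t)) by ring.
have hC : h * C * `|s - t| <= e * `|s - t|.
  rewrite ler_wpM2r// -ler_pdivlMr// (@le_trans _ _ (e / (2 * C)))//.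
    by rewrite ge_min lexx orbT.
  by rewrite ler_pM2l// lef_pV2 ?posrE ?mulr_gt0// ler_peMl ?ler1n// ltW.
apply: le_trans hC; rewrite /C.
apply: le_trans (ler_normD _ _) _.
have := ler_normD (V (xi s) s (pi s) - V (xi t) t (pi t) - (dotv gx (xi s - xi t) +
      gt * (s - t) + dotv gu (pi s - pi t))) (dotv gx (xi s - xi t) - dotv gx v * (s - t)).
move: DP lx lu; rewrite -/gx -/gu -/gt; lra.
Qed.

End strict_differentiability.

(** * Monotonicity from an almost everywhere sign *)

Section monotonicity.
Variable R : realType.
Local Notation mu := (@lebesgue_measure R).

(* Cousin's lemma, phrased without partitions. *)
Lemma interval_induction (P : R -> R -> Prop) (a b : R) : a <= b ->
  (forall x, a <= x <= b -> exists2 D, 0 < D & forall u v, a <= u <= x ->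
     x <= v <= b -> x - D < u -> v < x + D -> P u v) ->
  (forall u v w, u <= v <= w -> P u v -> P v w -> P u w) -> P a b.
Proof.
(* The supremum of the reachable right ends is itself reachable, by the local property on its left,
   and equals [b], since otherwise the local property on its right would pass it. *)
move=> ab loc glue; pose S := [set y | a <= y <= b /\ P a y].
have Sa : S a.
  split; first by rewrite lexx.
  have [|D D0 DP] := loc a; first by rewrite lexx.
  by apply: DP; rewrite ?lexx// ?ltrBlDr ltrDl.
have supS : has_sup S by split; [exists a|exists b => y [/andP[]]].
have as_ : a <= sup S by apply: ub_le_sup => //; case: supS.
have supS_b : sup S <= b by apply: ge_sup; [exists a|move=> y [/andP[]]].
have [|D D0 DP] := loc (sup S); first by rewrite as_ supS_b.
have [y [/andP[ay yb] Pay] ys] := sup_adherent D0 supS.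
have ys' : y <= sup S by apply: ub_le_sup; [case: supS|split; rewrite ?ay].
have Pas : P a (sup S).
  apply: (glue _ y) => //; first by rewrite ay.
  by apply: DP; rewrite ?ay ?lexx ?supS_b// ltrDl.
have [bs|sb'] := leP b (sup S).
  by rewrite (_ : b = sup S)//; apply/eqP; rewrite eq_le bs.
pose v := Num.min b (sup S + D / 2).
have sv : sup S < v by rewrite lt_min sb' ltrDl divr_gt0.
have : v <= sup S.
  apply: ub_le_sup; first by case: supS.
  have vb : v <= b by rewrite ge_min lexx.
  split; first by rewrite vb (le_trans as_ (ltW sv)).
  apply: (glue _ (sup S)) => //; first by rewrite as_ ltW.
  apply: DP; rewrite ?as_ ?lexx ?vb ?(ltW sv) ?ltrBlDr ?ltrDl//.
  by rewrite gt_min ltrD2l gtr_pMr ?invf_lt1 ?ltr1n ?orbT.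
by rewrite leNgt sv.
Qed.

Lemma negligible_open_cover (N : set R) (e : R) : mu.-negligible N -> 0 < e ->
  exists O : set R, [/\ open O, N `<=` O & (mu O < e%:E)%E].
Proof.
move=> [B [mB B0 NB]] e0.
have Boo : (mu B < +oo)%E by rewrite [ltLHS]B0 ltry.
have [ O [oO BO OB]] := lebesgue_regularity_outer mB Boo e0.
exists O; split=> //; first exact: subset_trans BO.
rewrite -(setDUK BO) measureU//.
- by rewrite [X in (X + _)%E](B0 : mu B = 0%E) add0e.
- by apply: measurableD => //; exact: open_measurable.
- by rewrite setDE setIA setIC setIA setICl set0I.
Qed.

Lemma sum_itv_le_measure (k : nat) (s t : 'I_k -> R) (O : set R) (e : R) :
  open O -> (mu O < e%:E)%E -> (forall i, s i <= t i) ->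
  (forall i, `]s i, t i[ `<=` O) ->
  trivIset setT (fun i => `]s i, t i[%classic) ->
  \sum_i (t i - s i) < e.
Proof.
move=> oO Oe st sO tst; rewrite -lte_fin; apply: le_lt_trans Oe.
have -> : (\sum_i (t i - s i))%:E =
    mu (\big[setU/set0]_(i < k) `]s i, t i[%classic).
  rewrite measure_semi_additive_ord//.
    rewrite -sumEFin; apply: eq_bigr => i _.
    apply/esym; apply: (etrans (lebesgue_measure_itv `]s i, t i[)).
    rewrite /= lte_fin; have := st i.
    by rewrite le_eqVlt => /predU1P[->|->]; rewrite ?ltxx ?subrr// EFinB.
  by apply: bigsetU_measurable.
apply: le_measure; rewrite ?inE.
- by apply: bigsetU_measurable.
- exact: open_measurable.
- by elim/big_ind : _ => [y []|A B AO BO y [/AO|/BO]|i _]//; exact: sO.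
Qed.

Lemma ac_uniform n (a b : R) (phi : R -> 'cV[R]_n) : abs_continuous a b phi ->
  forall e, 0 < e -> exists2 D, 0 < D & forall s t, a <= s -> s <= t -> t <= b ->
    t - s < D -> enorm (phi t - phi s) < e.
Proof.
move=> ac e e0; have [D D0 DP] := ac _ e0; exists D => // s t as_ st tb tsD.
have := DP 1%N (fun=> s) (fun=> t); rewrite !big_ord1; apply => //.
by move=> i j _ _ _; rewrite [i]ord1 [j]ord1.
Qed.

Lemma ac_within_continuous n (a b : R) (phi : R -> 'cV[R]_n) :
  abs_continuous a b phi -> {within `[a, b], continuous phi}.
Proof.
move=> ac; apply/subspace_continuousP => x /=; rewrite in_itv/= => /andP[ax xb].
apply/cvgrPdist_le => /= e e0; rewrite near_withinE.
have [D D0 DP] := ac_uniform ac e0.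
have /cvgrPdist_lt/(_ _ D0) : s @[s --> x] --> x by exact: cvg_id.
apply: filterS => s sx; rewrite /= in_itv/= => /andP[as_ sb].
apply: norm_le_coord => [|i j]; first exact: ltW.
rewrite [j]ord1; have [xs|/ltW sx'] := leP x s.
  rewrite -opprB mxE normrN (le_trans (coord_le_enorm _ _))//; apply/ltW/DP => //.
  by apply: le_lt_trans sx; rewrite distrC ler_norm.
rewrite (le_trans (coord_le_enorm _ _))//; apply/ltW/DP => //.
by apply: le_lt_trans sx; rewrite ler_norm.
Qed.

(** The third hypothesis on [w] charges its local increments to the motion of [phi] with one
    constant [K]. Absolute continuity is thus asked of [phi] alone, and it is used once, on all the
    exceptional intervals together. *)
Lemma ae_nonincreasing n (phi : R -> 'cV[R]_n) (w : R -> R) (a b K : R) :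
  0 <= a -> a <= b -> 0 <= K -> abs_continuous a b phi ->
  (forall x, a <= x <= b -> exists2 D, 0 < D & forall u v, a <= u <= x ->
     x <= v <= b -> x - D < u -> v < x + D ->
     w v - w u <= K * (enorm (phi v - phi u) + (v - u))) ->
  {ae mu, forall t, a < t < b -> exists2 l : R, l <= 0 & tder w t l} ->
  w b <= w a.
Proof.
move=> a0 ab K0 ac wK [N [mN N0 NP]].
(* The derivative is only given inside []a, b[], so both ends join the exceptional set. *)
pose A := N `|` [set a] `|` [set b].
have neg1 (x : R) : mu.-negligible [set x].
  by exists [set x]; split => //; exact: lebesgue_measure_set1.
have negA : mu.-negligible A.
  apply: negligibleU; last exact: neg1.
  apply: negligibleU; last exact: neg1.
  by exists N; split.
have AP t : a <= t <= b -> ~ A t -> exists2 l, l <= 0 & tder w t l.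
  move=> /andP[at_ tb] At; apply: contrapT => tl; apply: At.
  have [->|ta] := eqVneq t a; first by left; right.
  have [->|tb'] := eqVneq t b; first by right.
  left; left; apply: NP => /= tN; apply: tl; apply: tN.
  by rewrite !lt_neqAle at_ tb tb' eq_sym ta.
(* The points of differentiability cost [e * (b - a)]. The two halves of [e * 2] are the total
   motion of [phi] and the total length over the exceptional intervals. *)
suff main e : 0 < e -> w b - w a <= e * (b - a + K * 2).
  rewrite -subr_le0; apply/ler_addgt0Pr => e e0; rewrite add0r.
  pose c := b - a + K * 2 + 1.
  have c0 : 0 < c by rewrite ltr_wpDl// addr_ge0 ?subr_ge0// mulr_ge0.
  have ec : 0 < e / c by rewrite divr_gt0.
  apply: le_trans (main _ ec) _; rewrite mulrAC ler_pdivrMr// ler_pM2l//.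
  by rewrite /c lerDl.
move=> e0; have [d d0 dP] := ac _ e0.
have de0 : 0 < Num.min d e by rewrite lt_min d0.
have [ O [oO AO Ode]] := negligible_open_cover negA de0.
pose inc (i : R * R) := enorm (phi i.2 - phi i.1) + (i.2 - i.1).
(* The induction carries the list of exceptional intervals met so far, ordered and inside [O]. Lists
   glue by concatenation, while bounding the sum must wait for the complete list: bounds for two
   families separately would add up at each gluing. *)
pose P u v := exists l : seq (R * R),
  [/\ forall i, i \in l -> [/\ u <= i.1, i.1 <= i.2, i.2 <= v &
        `]i.1, i.2[ `<=` O],
      pairwise (fun i j : R * R => i.2 <= j.1) l &
      w v - w u <= e * (v - u) + K * \sum_(i <- l) inc i].
have [l [lP lpair wl]] : P a b.
  apply: interval_induction => //; last first.
    move=> u v x /andP[uv vx] [l1 [l1P p1 w1]] [l2 [l2P p2 w2]].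
    exists (l1 ++ l2); split.
    - move=> i; rewrite mem_cat => /orP[/l1P[i1 i2 i3 i4]|/l2P[i1 i2 i3 i4]].
        by split=> //; exact: le_trans vx.
      by split=> //; exact: le_trans i1.
    - rewrite pairwise_cat p1 p2 !andbT; apply/allrelP => i j /l1P[_ _ iv _].
      by move=> /l2P[vj _ _ _]; exact: le_trans vj.
    - by rewrite big_cat/=; move: w1 w2; lra.
  (* An exceptional point contributes the single interval [(u, v)], a point of differentiability the
     empty list. *)
  move=> x xab; have [xA|/AP] := pselect (A x).
    have [D D0 DP] := wK x xab.
    have /nbhs_ballP[D' /= D'0 D'P] : nbhs x O by exact: open_nbhs_nbhs (conj oO (AO _ xA)).
    exists (Num.min D D'); first by rewrite lt_min D0.
    move=> u v /andP[au ux] /andP[xv vb] xu vx.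
    have DD : Num.min D D' <= D by rewrite ge_min lexx.
    have DD' : Num.min D D' <= D' by rewrite ge_min lexx orbT.
    exists [:: (u, v)]; split => //.
    - move=> i; rewrite inE => /eqP -> /=; split => //.
        exact: le_trans xv.
      move=> y; rewrite /= in_itv/= => /andP[uy yv]; apply: D'P.
      by rewrite /ball/= ltr_norml; apply/andP; split; lra.
    - rewrite big_seq1 /inc/=.
      apply: (@le_trans _ _ (K * (enorm (phi v - phi u) + (v - u)))).
        by apply: DP; rewrite ?au ?xv//; lra.
      by rewrite lerDr mulr_ge0 ?(ltW e0)// subr_ge0 (le_trans ux).
  move=> /(_ xab)[l l0 dl].
  have /nbhs_ballP[D /= D0 DP] := dl _ e0.
  exists D => // u v /andP[au ux] /andP[xv vb] xu vx; exists [::]; split => //.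
  rewrite big_nil mulr0 addr0.
  have vD : ball x D v by rewrite /ball/= ltr_norml; apply/andP; split; lra.
  have uD : ball x D u by rewrite /ball/= ltr_norml; apply/andP; split; lra.
  have := DP v vD; have := DP u uD => /=.
  have u0 : 0 <= u by lra.
  have v0 : 0 <= v by lra.
  move=> /(_ u0) + /(_ v0); rewrite (ler0_norm (_ : u - x <= 0)) ?subr_le0//.
  rewrite (ger0_norm (_ : 0 <= v - x)) ?subr_ge0// !ler_norml.
  move=> /andP[h1 _] /andP[_ h2].
  have h3 : l * (v - x) <= 0 by rewrite mulr_le0_ge0 ?subr_ge0.
  have h4 : 0 <= l * (u - x) by rewrite mulr_le0 ?subr_le0.
  lra.
apply: le_trans wl _; rewrite [leRHS]mulrDr lerD2l mulrCA ler_wpM2l//.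
pose s (i : 'I_(size l)) := (nth (0, 0) l i).1.
pose t (i : 'I_(size l)) := (nth (0, 0) l i).2.
have stl i : [/\ a <= s i, s i <= t i, t i <= b & `]s i, t i[ `<=` O].
  by apply: lP; exact: mem_nth.
have tst : trivIset setT (fun i => `]s i, t i[%classic).
  have ord (i j : 'I_(size l)) : (i < j)%N -> t i <= s j.
    by move=> ij; have /(pairwiseP (0, 0)) := lpair; apply; rewrite ?inE.
  move=> i j _ _ [y [/=]]; rewrite !in_itv/= => /andP[si ti] /andP[sj tj].
  apply: val_inj; case: (ltngtP i j) => // /ord h; exfalso; lra.
have sum_lt : \sum_i (t i - s i) < Num.min d e.
  by apply: sum_itv_le_measure oO Ode _ _ tst => i; have [] := stl i.
rewrite (big_nth (0, 0)) big_mkord big_split/= mulr_natr mulr2n lerD//.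
  apply/ltW/dP => //; first by move=> i; have [] := stl i.
  by apply: lt_le_trans sum_lt _; rewrite ge_min lexx.
by apply/ltW/(lt_le_trans sum_lt); rewrite ge_min lexx orbT.
Qed.

(** A parameter of dimension zero makes a function of [x] and [t] an instance of the three-argument
    case, so that [C1_strict] and [C1_chain_rule] apply to it. *)
Lemma C1_xt_xttau n (W : 'cV[R]_n -> R -> R) : C1_xt W ->
  C1_xttau (fun x t (_ : 'cV[R]_0) => W x t).
Proof.
move=> [dW cW cx ct].
have lift (U : topologicalType) (F : 'cV[R]_n * R -> U) :
    {within [set z | 0 <= z.2], continuous F} ->
    {within @dom_xtau R n 0, continuous (fun z => F z.1)}.
  move=> cF; apply: within_continuous_comp cF _ _ => //.
  by apply: continuous_subspaceT => z; exact: cvg_fst.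
split.
- by move=> x t tau t0; have [] := dW x t t0; split=> // -[].
- exact: lift cW.
- exact: lift cx.
- exact: lift ct.
by apply: continuous_subspaceT => z; apply: mx_continuous; case.
Qed.

Lemma C1_xt_ae_nonincreasing n (W : 'cV[R]_n -> R -> R) (phi : R -> 'cV[R]_n)
    (a b : R) : C1_xt W -> 0 <= a -> a <= b -> abs_continuous a b phi ->
  {ae mu, forall t, a < t < b -> exists2 v : 'cV[R]_n, is_derive t 1 phi v &
    tderive (W (phi t)) t + dotv (grad (W^~ t) (phi t)) v <= 0} ->
  W (phi b) b <= W (phi a) a.
Proof.
move=> CW a0 ab ac decr.
have CV := C1_xt_xttau CW; case: (CW) => dW cW cx ct.
have cphi := ac_within_continuous ac.
have cpair : {within `[a, b], continuous (fun s => (phi s, s))}.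
  apply: within_continuous_pair => //.
  by apply: continuous_subspaceT => z; exact: cvg_id.
have dom s : `[a, b]%classic s -> [set z : 'cV[R]_n * R | 0 <= z.2] (phi s, s).
  by rewrite /= in_itv/= => /andP[as_ _]; exact: le_trans as_.
have bounded (U : normedModType R) (F : 'cV[R]_n * R -> U) :
    {within [set z | 0 <= z.2], continuous F} ->
    exists B, forall s, a <= s <= b -> `|F (phi s, s)| <= B.
  move=> cF.
  have cN : {within `[a, b], continuous (fun s => `|F (phi s, s)|)}.
    have cFphi := within_continuous_comp cF cpair dom.
    by move=> x; apply: continuous_comp (cFphi x) _; exact: norm_continuous.
  have [c _ cmax] := EVT_max ab cN.
  by exists `|F (phi c, c)| => s sab; apply: cmax; rewrite in_itv.
have [Bx BxP] := bounded _ _ cx; have [Bt BtP] := bounded _ _ ct.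
(* Along the compact curve [B] bounds the partials; the [1] added to it is the error allowed in
   strict differentiability, and [n] compares the sum norm with [enorm]. *)
pose B := Num.max Bx Bt; pose K := (B + 1) * (n%:R + 1).
have B0 : 0 <= B.
  rewrite le_max; apply/orP; left; apply: le_trans (BxP a _) => //.
  by rewrite lexx.
apply: (@ae_nonincreasing n phi (fun s => W (phi s) s) a b K) => //.
- by rewrite mulr_ge0// addr_ge0.
- move=> x xab; have x0 : 0 <= x by case/andP: xab => ax _; exact: le_trans ax.
  have [D D0 DP] := C1_strict CV (phi x) 0 x0 ltr01.
  have [D' D'0 D'P] := ac_uniform ac D0.
  exists (Num.min D D'); first by rewrite lt_min D0.
  move=> u v /andP[au ux] /andP[xv vb] xu vx.
  have [DD DD'] : Num.min D D' <= D /\ Num.min D D' <= D'.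
    by rewrite !ge_min !lexx orbT.
  have near_phi s t : a <= s -> s <= t -> t <= b -> t - s < D' ->
      `|phi t - phi s| < D.
    move=> as_ st tb ts.
    apply: le_lt_trans (D'P _ _ as_ st tb ts).
    by apply: norm_le_coord => [|i j]; [exact: enorm_ge0|rewrite [j]ord1 coord_le_enorm].
  have uD : `|phi u - phi x| < D.
    by rewrite distrC; apply: near_phi => //; lra.
  have vD : `|phi v - phi x| < D by apply: near_phi => //; lra.
  have uxD : `|u - x| < D by rewrite ltr_norml; apply/andP; split; lra.
  have vxD : `|v - x| < D by rewrite ltr_norml; apply/andP; split; lra.
  have z0 : `|(0 : 'cV[R]_0) - 0| < D by rewrite subrr normr0.
  have u0 : 0 <= u by lra.
  have v0 : 0 <= v by lra.
  have := DP _ _ _ _ 0 0 uD vD uxD vxD z0 z0 u0 v0.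
  set g := V_x _ _ _ _; set l := V_t _ _ _ _.
  rewrite [dotv _ (0 - 0)]big_ord0 [norm1 (0 - 0)]big_ord0 !addr0 mul1r.
  have -> : `|v - u| = v - u by rewrite ger0_norm// subr_ge0 (le_trans ux).
  move=> strict.
  have gB : `|dotv g (phi v - phi u)| <= B * norm1 (phi v - phi u).
    apply: dotv_le_coord => i; apply: le_trans (norm_coord_le _ _ _) _.
    by rewrite le_max BxP// xab.
  have lB : `|l * (v - u)| <= B * (v - u).
    rewrite normrM [X in _ * X]ger0_norm ?subr_ge0 ?(le_trans ux)//.
    rewrite ler_wpM2r ?subr_ge0 ?(le_trans ux)//.
    by rewrite le_max BtP ?orbT// xab.
  have nE : norm1 (phi v - phi u) <= n%:R * enorm (phi v - phi u).
    exact: sum_coord_le_enorm.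
  have nE' : (B + 1) * norm1 (phi v - phi u) <= (B + 1) * (n%:R * enorm (phi v - phi u)).
    by rewrite ler_wpM2l// addr_ge0.
  have E0 : 0 <= (B + 1) * enorm (phi v - phi u).
    by rewrite mulr_ge0 ?enorm_ge0// addr_ge0.
  have T0 : 0 <= (B + 1) * n%:R * (v - u).
    by rewrite mulr_ge0 ?subr_ge0 ?(le_trans ux)// mulr_ge0// addr_ge0.
  move: strict gB lB; rewrite !ler_norml /K.
  move=> /andP[_ h1] /andP[_ h2] /andP[_ h3].
  by move: h1 h2 h3 nE' E0 T0; lra.
- apply: (@filterS _ _ (ae_filter_ringOfSetsType mu) _ _ _ decr).
  move=> t dt /[dup] tab /dt[v dphi le0].
  have t0 : 0 <= t by case/andP: tab => at_ _; exact: le_trans (ltW at_).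
  eexists; first exact: le0.
  have := @C1_chain_rule R n 0 _ CV phi (fun=> 0) t v 0 t0.
  rewrite [dotv _ 0]big_ord0 addr0 [X in tder _ _ X]addrC; apply; last by case.
  move=> i; apply: is_derive_tder.
  have [/derivable_mxP dij] := dphi.
  rewrite derive_mx; last by case: dphi.
  move=> /colP/(_ i); rewrite mxE => <-.
  exact/derivableP.
Qed.

End monotonicity.

(** * Exponentially decaying Lyapunov functions *)

Section time_weight.
Variables (R : realType) (n : nat).

Lemma tder_within_continuous (E E' : R -> R) :
  (forall t, 0 <= t -> tder E t (E' t)) -> {within [set t | 0 <= t], continuous E}.
Proof.
move=> dE; apply/subspace_continuousP => t t0.
apply/cvgrPdist_le => e e0; rewrite near_withinE.
apply: filterS (tder_continuous (dE t t0) e0) => s sP s0.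
by rewrite distrC; exact: sP.
Qed.

Variables (E E' : R -> R) (W : 'cV[R]_n -> R -> R).
Hypotheses (dE : forall t, 0 <= t -> tder E t (E' t)).
Hypothesis cE' : {within [set t | 0 <= t], continuous E'}.
Hypothesis W_C1 : C1_xt W.

Let EW x t := E t * W x t.

Lemma grad_time_weight x t : 0 <= t -> grad (EW^~ t) x = E t *: grad (W^~ t) x.
Proof.
move=> t0; apply/colP => i; rewrite !mxE.
have [dW _ _ _] := W_C1; have [dx _] := dW x t t0.
by rewrite -[RHS](deriveZ (E t) (dx i)).
Qed.

Lemma tder_time_weight x t : 0 <= t ->
  tder (EW x) t (E' t * W x t + E t * tderive (W x) t).
Proof.
move=> t0; have [dW _ _ _] := W_C1; have [_ dt] := dW x t t0.
by apply: tder_mul; [exact: dE|exact: tderivable_tder].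
Qed.

Lemma tderive_time_weight x t : 0 <= t ->
  tderive (EW x) t = E' t * W x t + E t * tderive (W x) t.
Proof. by move=> t0; have [] := tder_tderive t0 (tder_time_weight x t0). Qed.

(** Multiplication by a function of time occurs twice: with the averaging weight of [Vsharp] and
    with the integrating factor [expR (lam * t)]. *)
Lemma C1_time_weight : C1_xt EW.
Proof.
have [dW cW cx ct] := W_C1.
have c_snd (F : R -> R) : {within [set t | 0 <= t], continuous F} ->
    {within [set z : 'cV[R]_n * R | 0 <= z.2], continuous (fun z => F z.2)}.
  move=> cF; apply: within_continuous_comp cF _ _ => //.
  by apply: continuous_subspaceT => z; exact: cvg_snd.
have cE := c_snd _ (tder_within_continuous dE).
have cE'_snd := c_snd _ cE'.
split.
- move=> x t t0; have [dx _] := dW x t t0; split.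
    by move=> i; apply: derivableZ; exact: dx.
  by have [] := tder_tderive t0 (tder_time_weight x t0).
- by move=> z; apply: cvgM; [exact: cE|exact: cW].
- have : {within [set z : 'cV[R]_n * R | 0 <= z.2], continuous
      (fun z => E z.2 *: grad (W^~ z.2) z.1)}.
    by move=> z; apply: cvgZ; [exact: cE|exact: cx].
  apply: subspace_eq_continuous => z; rewrite in_setE /from_subspace/= => z0.
  by rewrite grad_time_weight.
- have : {within [set z : 'cV[R]_n * R | 0 <= z.2], continuous
      (fun z => E' z.2 * W z.1 z.2 + E z.2 * tderive (W z.1) z.2)}.
    move=> z; apply: cvgD; apply: cvgM;
      [exact: cE'_snd|exact: cW|exact: cE|exact: ct].
  apply: subspace_eq_continuous => z; rewrite in_setE /from_subspace/= => z0.
  by rewrite tderive_time_weight.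
Qed.

End time_weight.

Section lyapunov.
Variables (R : realType) (n m : nat).
Local Notation mu := (@lebesgue_measure R).

Lemma input_norm_ae (u : R -> 'cV[R]_m) : input u ->
  0 <= fine (input_norm u) /\
  {ae mu, forall t, 0 <= t -> enorm (u t) <= fine (input_norm u)}.
Proof.
move=> [_ u_fin].
have u_ge0 : (0 <= input_norm u)%E.
  (* An essential supremum of nonnegative values is nonnegative because the measure is not zero. *)
  have muT : (0 < mu [set: R])%E.
    by rewrite -(@set_itvNyy _ R) lebesgue_measure_itv/= ltry.
  apply: ess_sup_gee => //.
  apply: nearW => t; rewrite patchE; case: ifP => // _.
  by rewrite lee_fin enorm_ge0.
have finN : input_norm u \is a fin_num by rewrite ge0_fin_numE.
split; first exact: fine_ge0.
have := @ess_sup_ge _ _ _ mu ((fun t => (enorm (u t))%:E) \_ `[0, +oo[).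
apply: (@filterS _ _ (ae_filter_ringOfSetsType mu)) => t + t0.
rewrite patchE mem_set/= ?in_itv/= ?t0// => ut.
by rewrite -lee_fin fineK.
Qed.

Lemma ac_sub (a b c d : R) (phi : R -> 'cV[R]_n) : a <= c -> d <= b ->
  abs_continuous a b phi -> abs_continuous c d phi.
Proof.
move=> ac db h e /h[D D0 DP]; exists D => // k s t st; apply: DP => i.
have [cs [st' td]] := st i.
by rewrite st' (le_trans ac cs) (le_trans td db).
Qed.

(** Let [s] be the last time in [[a, b]] with [W <= M], or [a] if there is none. Beyond [s] the
    decay estimate is in force, so [expR (lam * t) * W] does not increase on [[s, b]]; the two cases
    for [s] give the two entries of the maximum. *)
Lemma exp_decay_above_level (W : 'cV[R]_n -> R -> R) (phi v : R -> 'cV[R]_n)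
    (lam M a b : R) : C1_xt W -> 0 < lam -> 0 <= M -> 0 <= a -> a <= b ->
  abs_continuous a b phi ->
  {ae mu, forall t, a < t < b -> is_derive t 1 phi (v t) /\
    (M < W (phi t) t -> tderive (W (phi t)) t + dotv (grad (W^~ t) (phi t)) (v t)
      <= - lam * W (phi t) t)} ->
  W (phi b) b <= Num.max (expR (- lam * (b - a)) * W (phi a) a) M.
Proof.
move=> CW lam0 M0 a0 ab ac decay; pose w t := W (phi t) t.
pose S := [set t | a <= t <= b /\ (t = a \/ w t <= M)].
have Sa : S a by split; [rewrite lexx|left].
have supS : has_sup S by split; [exists a|exists b => t [/andP[]]].
pose s := sup S.
have as_ : a <= s by apply: ub_le_sup => //; case: supS.
have sb : s <= b by apply: ge_sup; [exists a|move=> y [/andP[]]].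
have cw : {within `[a, b], continuous w}.
  have [_ cW _ _] := CW.
  apply: within_continuous_comp cW (within_continuous_pair
    (ac_within_continuous ac) _) _.
    by apply: continuous_subspaceT => z; exact: cvg_id.
  by move=> t; rewrite /= in_itv/= => /andP[at_ _]; exact: le_trans at_.
have sS : s = a \/ w s <= M.
  have [->|sa] := eqVneq s a; [by left|right].
  have {}sa : a < s by rewrite lt_neqAle eq_sym sa.
  rewrite leNgt; apply/negP => Mw.
  have sab : `[a, b]%classic s by rewrite /= in_itv/= as_.
  have /cvgr_gt/(_ _ Mw) := (subspace_continuousP _ _).1 cw s sab.
  rewrite near_withinE => /nbhs_ballP[D /= D0 DP].
  (* Staying within [s - a] of [s] rules out the point [a], which belongs to [S] whatever the value
     of [w] there. *)
  have D'0 : 0 < Num.min D (s - a) by rewrite lt_min D0 subr_gt0.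
  have [r [rab rS] sr] := sup_adherent D'0 supS.
  have rs : r <= s by apply: ub_le_sup; [case: supS|].
  have : a < r /\ s - D < r.
    have : Num.min D (s - a) <= D /\ Num.min D (s - a) <= s - a.
      by rewrite !ge_min !lexx orbT.
    by move: sr; rewrite -/s; lra.
  move=> [ar Dr]; case: rS => [ra|]; first by move: ar; rewrite ra ltxx.
  rewrite leNgt DP ?in_itv//.
  by rewrite /ball/= ger0_norm ?subr_ge0//; lra.
have above t : s < t -> t <= b -> M < w t.
  move=> st tb; rewrite ltNge; apply/negP => wM.
  have : t <= s.
    apply: ub_le_sup; first by case: supS.
    by split; [rewrite tb (le_trans as_ (ltW st))|right].
  by rewrite leNgt st.
pose E (t : R) := expR (lam * t).
have dE t : 0 <= t -> tder E t (lam * E t).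
  move=> _; apply: is_derive_tder; rewrite /E mulrC.
  apply: (@is_derive1_comp R expR (fun t => lam * t)).
  by rewrite -[X in is_derive _ _ _ X]mulr1; apply: is_deriveZ.
have cE' : {within [set t | 0 <= t], continuous (fun t => lam * E t)}.
  apply: continuous_subspaceT => t; apply: cvgM; first exact: cvg_cst.
  apply: (@continuous_comp _ _ _ (fun t => lam * t) expR).
    by apply: cvgM; [exact: cvg_cst|exact: cvg_id].
  exact: continuous_expR.
have Ew : E b * w b <= E s * w s.
  apply: (@C1_xt_ae_nonincreasing R n (fun x t => E t * W x t) phi s b) => //.
  - exact: C1_time_weight dE cE' CW.
  - exact: le_trans as_.
  - exact: ac_sub ac.
  apply: (@filterS _ _ (ae_filter_ringOfSetsType mu)) decay => t tP /andP[st tb].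
  have at_ := le_lt_trans as_ st.
  have t0 : 0 <= t by exact: le_trans a0 (ltW at_).
  have [|dphi /(_ (above _ st (ltW tb))) le0] := tP; first by rewrite at_.
  exists (v t) => //.
  rewrite (tderive_time_weight dE CW)// (grad_time_weight _ CW)//.
  rewrite dotvZl.
  have -> : lam * E t * W (phi t) t + E t * tderive (W (phi t)) t +
      E t * dotv (grad (W^~ t) (phi t)) (v t) = E t * (lam * W (phi t) t +
      (tderive (W (phi t)) t + dotv (grad (W^~ t) (phi t)) (v t))) by ring.
  by rewrite mulr_ge0_le0 ?expR_ge0//; lra.
have Eb0 : 0 < E b by exact: expR_gt0.
have {Ew} : w b <= expR (- lam * (b - s)) * w s.
  rewrite -(ler_pM2l Eb0) mulrA -expRD.
  by have -> : lam * b + - lam * (b - s) = lam * s by ring.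
rewrite le_max; case: sS => [->->//|ws] wb.
apply/orP; right; apply: le_trans wb _; apply: le_trans (ler_wpM2l _ ws) _.
  exact: expR_ge0.
rewrite ler_piMl// -expR0 ler_expR mulNr oppr_le0 mulr_ge0 ?subr_ge0//.
exact: ltW.
Qed.

(** Let [U] be the norm of the input. Where [W] exceeds [a2 (chi^-1 U)], the upper bound gives
    [|x| > chi^-1 U], so the input is small enough for [W] to decay. Inverting the lower bound turns
    the estimate of [W] into one of the state, and a maximum of nonnegative terms is at most their
    sum, whence [beta + gamma]. *)
Theorem exp_Lyapunov_ISS (h : 'cV[R]_n -> R -> 'cV[R]_n)
    (J : 'cV[R]_n -> R -> 'M[R]_(n, m)) (W : 'cV[R]_n -> R -> R)
    (a1 a2 chi : R -> R) (lam : R) :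
  forward_complete h J -> C1_xt W -> 0 < lam ->
  Kinf a1 -> Kinf a2 -> Kinf chi ->
  (forall x t, 0 <= t -> a1 (enorm x) <= W x t <= a2 (enorm x)) ->
  (forall x t u, 0 <= t -> enorm u <= chi (enorm x) ->
    tderive (W x) t + dotv (grad (W^~ t) x) (h x t + J x t *m u)
      <= - lam * W x t) ->
  ISS h J.
Proof.
move=> hJ CW lam0 K1 K2 Kchi W12 decay; split=> //.
have [s1 Ks1 s1P] := Kinf_inverse K1.
have [sc Ksc scP] := Kinf_inverse Kchi.
exists (fun s t => s1 (expR (- lam * t) * a2 s)), (s1 \o (a2 \o sc)).
split; first exact: KL_exp.
  by apply: Kinf_comp => //; exact: Kinf_comp.
move=> t0 x0 u phi t0_ge0 /input_norm_ae[].
set U := fine _ => U0 uU [phi0 ac dphi] t t0t.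
pose M := a2 (sc U).
have scU := Kinf_ge0 Ksc U0.
have M0 : 0 <= M by exact: Kinf_ge0.
have ex0 := enorm_ge0 x0.
have wt : W (phi t) t <= Num.max (expR (- lam * (t - t0)) * W (phi t0) t0) M.
  move: t0t; rewrite le_eqVlt => /predU1P[<-|t0t].
    by rewrite subrr mulr0 expR0 mul1r le_max lexx.
  apply: (@exp_decay_above_level W phi
    (fun t => h (phi t) t + J (phi t) t *m u t)) => //; first exact: ltW.
    exact: ac.
  have := @filterI _ _ (ae_filter_ringOfSetsType mu) _ _ uU dphi.
  apply: (@filterS _ _ (ae_filter_ringOfSetsType mu)) => r [ur dr] /andP[t0r _].
  have r0 : 0 <= r by exact: le_trans (ltW t0r).
  split; first exact: dr.
  move=> MW; apply: decay => //; apply: le_trans (ur r0) _.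
  rewrite -[leLHS](scP _ U0).2; apply/ltW/Kinf_ltr => //.
  apply: (Kinf_lt_inv K2) => //; first exact: enorm_ge0.
  by apply: lt_le_trans MW _; case/andP: (W12 (phi r) r r0).
have [/andP[a1W _] /andP[_ Wa2]] := (W12 (phi t) t (le_trans t0_ge0 t0t), W12 x0 t0 t0_ge0).
have a1_le : a1 (enorm (phi t)) <=
    Num.max (expR (- lam * (t - t0)) * a2 (enorm x0)) M.
  apply: le_trans a1W (le_trans wt _); rewrite phi0 ge_max !le_max lexx orbT andbT.
  by rewrite ler_wpM2l// expR_ge0.
have arg0 : 0 <= expR (- lam * (t - t0)) * a2 (enorm x0).
  by rewrite mulr_ge0 ?expR_ge0// Kinf_ge0.
have b0 := Kinf_ge0 Ks1 arg0; have g0 := Kinf_ge0 Ks1 M0.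
rewrite -[leLHS](s1P _ (enorm_ge0 _)).1.
have a1_ge0 := Kinf_ge0 K1 (enorm_ge0 (phi t)).
move: a1_le; rewrite le_max => /orP[] le1.
  by apply: le_trans (Kinf_ler Ks1 a1_ge0 le1) _; rewrite lerDl.
by apply: le_trans (Kinf_ler Ks1 a1_ge0 le1) _; rewrite lerDr.
Qed.

End lyapunov.

(** * The averaging weight *)

Section primitives.
Variable R : realType.
Local Notation mu := (@lebesgue_measure R).

Lemma is_derive_continuous (F : R -> R) (x l : R) :
  is_derive x 1 F l -> {for x, continuous F}.
Proof.
by move=> dF; apply/differentiable_continuous/derivable1_diffP; case: dF.
Qed.

Lemma exists_primitive (k : R -> R) (a : R) :
  (forall x, a <= x -> {for x, continuous k}) ->
  exists K : R -> R, forall x, a < x -> is_derive x 1 K (k x).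
Proof.
move=> ck; exists (fun x => \int[mu]_(t in `[a, x]) k t) => x ax.
have xx1 : x < x + 1 by rewrite ltrDl.
have ik : mu.-integrable `[a, x + 1] (EFin \o k).
  apply: continuous_compact_integrable; first exact: segment_compact.
  apply/subspace_continuousP => y /=; rewrite in_itv/= => /andP[ay _].
  by apply: cvg_within_filter; exact: ck.
have [dK K'] := continuous_FTC1_closed xx1 ik ax (ck x (ltW ax)).
by apply: DeriveDef => //; rewrite -derive1E.
Qed.

Lemma Rintegral_primitive (k K : R -> R) (a b : R) : a <= b ->
  (forall x, a <= x <= b -> is_derive x 1 K (k x)) ->
  (forall x, a <= x <= b -> {for x, continuous k}) ->
  \int[mu]_(x in `[a, b]) k x = K b - K a.
Proof.
rewrite le_eqVlt => /predU1P[->|ab] dK ck.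
  by rewrite set_itv1 Rintegral_set1 subrr.
have cK x : a <= x <= b -> {for x, continuous K}.
  by move=> /dK; exact: is_derive_continuous.
rewrite /Rintegral (@continuous_FTC2 _ k K)//.
- apply/subspace_continuousP => y /=; rewrite in_itv/= => aby.
  by apply: cvg_within_filter; exact: ck.
- split.
  + move=> x; rewrite in_itv/= => /andP[/ltW ax /ltW xb].
    by have [] := dK x; rewrite ?ax.
  + by apply: cvg_at_right_filter; apply: cK; rewrite lexx ltW.
  + by apply: cvg_at_left_filter; apply: cK; rewrite lexx ltW.
- move=> x; rewrite in_itv/= => /andP[/ltW ax /ltW xb].
  by rewrite derive1E; have [] := dK x; rewrite ?ax.
Qed.

Lemma is_derive1_affine (F : R -> R) (c b t l : R) :
  is_derive (c * t + b) 1 F l -> is_derive t 1 (fun s => F (c * s + b)) (c * l).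
Proof.
move=> dF; rewrite mulrC; apply: (@is_derive1_comp R F (fun s => c * s + b)).
rewrite -[X in is_derive _ _ _ X]addr0; apply: is_deriveD.
by rewrite -[X in is_derive _ _ _ X]mulr1; apply: is_deriveZ.
Qed.

Section averaging.
Variables (k : R -> R) (T alpha Q : R).
Hypotheses (ck : continuous k) (kQ : forall x, `|k x| <= Q).
Hypotheses (T0 : 0 < T) (alpha0 : 0 < alpha).

Definition weight (t : R) : R := expR (alpha / T *
  \int[mu]_(s in `[t / alpha - T, t / alpha])
    \int[mu]_(l in `[s, t / alpha]) k l).

Definition weight_rate (t : R) : R :=
  k (t / alpha) - T^-1 * \int[mu]_(l in `[t / alpha - T, t / alpha]) k l.

(* With primitives [K] of [k] and [L] of [K], the double integral over a window
   ending at [r] is [T * K r - (L r - L (r - T))]. *)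
Lemma weight_primitives : exists K L : R -> R,
  [/\ forall x, - T <= x -> is_derive x 1 K (k x),
      forall x, - T <= x -> is_derive x 1 L (K x) &
      forall t, 0 <= t ->
        weight t = expR (alpha / T * (T * K (t / alpha) -
          (L (t / alpha) - L (t / alpha - T)))) /\
        weight_rate t =
          k (t / alpha) - T^-1 * (K (t / alpha) - K (t / alpha - T))].
Proof.
(* Windows ending at [t / alpha >= 0] reach back to [- T]. The margins [2] and [1] make both
   primitives differentiable from both sides there, [L] needing the continuity of [K] already from
   [- T - 1]. *)
have [K dK] := @exists_primitive k (- T - 2) (fun x _ => @ck x).
have [|L dL] := @exists_primitive K (- T - 1).
  by move=> x Tx; apply: is_derive_continuous (dK x _); lra.
exists K, L; split.
- by move=> x Tx; apply: dK; lra.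
- by move=> x Tx; apply: dL; lra.
move=> t t0; have r0 : 0 <= t / alpha by rewrite divr_ge0// ltW.
have T_gt0 : 0 < T := T0.
rewrite /weight /weight_rate; move: (t / alpha) r0 => r r0.
have inner s : r - T <= s -> s <= r -> \int[mu]_(l in `[s, r]) k l = K r - K s.
  move=> Ts sr; apply: Rintegral_primitive => // [x /andP[sx _]|x _].
    by apply: dK; lra.
  exact: ck.
have rT : r - T <= r by rewrite gerBl ltW.
split; last by rewrite inner.
congr (expR (_ * _)).
have -> : \int[mu]_(s in `[r - T, r]) \int[mu]_(l in `[s, r]) k l =
    \int[mu]_(s in `[r - T, r]) (K r - K s).
  apply: eq_Rintegral => s; rewrite in_setE/= in_itv/= => /andP[Ts sr].
  exact: inner.
have -> : \int[mu]_(s in `[r - T, r]) (K r - K s) =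
    (K r * r - L r) - (K r * (r - T) - L (r - T)).
  apply: (@Rintegral_primitive _ (fun s => K r * s - L s)) => //.
    move=> x /andP[Tx xr]; apply: is_deriveB; last by apply: dL; lra.
    by rewrite -[X in is_derive _ _ _ X]mulr1; apply: is_deriveZ.
  move=> x /andP[Tx xr]; apply: cvgB; first exact: cvg_cst.
  by apply: is_derive_continuous (dK x _); lra.
by ring.
Qed.

(** Differentiating the exponent of [weight_primitives] in [r = t / alpha] gives [alpha] times
    [weight_rate]; the inner derivative [1 / alpha] cancels that factor, which is why the double
    integral is scaled by [alpha]. *)
Lemma weight_tder (t : R) : 0 <= t -> tder weight t (weight_rate t * weight t).
Proof.
have [K [L [dK dL KLP]]] := weight_primitives.
move=> t0; have [-> ->] := KLP t t0.
have r0 : 0 <= t / alpha by rewrite divr_ge0// ltW.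
have T_gt0 : 0 < T := T0.
(* This formula is differentiable from both sides even at [t = 0], and agrees with [weight] for
   [s >= 0], which is all that [tder] sees. *)
pose F s := expR (alpha / T * (T * K (alpha^-1 * s + 0) -
          (L (alpha^-1 * s + 0) - L (alpha^-1 * s + (- T))))).
apply: (@eq_tder R F) => // [s s0|].
  by have [-> _] := KLP s s0; rewrite /F addr0 [alpha^-1 * s]mulrC.
apply: is_derive_tder; rewrite mulrC.
have -> : expR (alpha / T * (T * K (t / alpha) -
    (L (t / alpha) - L (t / alpha - T)))) = F t.
  by rewrite /F addr0 [alpha^-1 * t]mulrC.
apply: (@is_derive1_comp R expR (fun s => alpha / T * (T * K (alpha^-1 * s + 0) -
          (L (alpha^-1 * s + 0) - L (alpha^-1 * s + (- T)))))).
have rE : alpha^-1 * t + 0 = t / alpha by rewrite addr0 mulrC.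
have rE' : alpha^-1 * t + - T = t / alpha - T by rewrite mulrC.
have -> : k (t / alpha) - T^-1 * (K (t / alpha) - K (t / alpha - T)) =
  alpha / T * (T * (alpha^-1 * k (t / alpha)) -
    (alpha^-1 * K (t / alpha) - alpha^-1 * K (t / alpha - T))).
  by field; rewrite !gt_eqF.
apply: is_deriveZ; apply: is_deriveB.
  by apply: is_deriveZ; apply: is_derive1_affine; rewrite rE; apply: dK; lra.
apply: is_deriveB; apply: is_derive1_affine; rewrite ?rE ?rE'; apply: dL; lra.
Qed.

Lemma weight_rate_continuous :
  {within [set t | 0 <= t], continuous (fun t => weight_rate t * weight t)}.
Proof.
have [K [L [dK dL KLP]]] := weight_primitives.
have cw := tder_within_continuous weight_tder.
have cdiv (b : R) : continuous (fun t : R => t / alpha + b).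
  by move=> x; apply: cvgD; [apply: cvgM; [exact: cvg_id|exact: cvg_cst]|exact: cvg_cst].
have crate : {within [set t | 0 <= t], continuous weight_rate}.
  have : {within [set t | 0 <= t], continuous (fun t =>
      k (t / alpha) - T^-1 * (K (t / alpha) - K (t / alpha - T)))}.
    apply/subspace_continuousP => t t0; apply: cvg_within_filter.
    have r0 : 0 <= t / alpha by rewrite divr_ge0// ltW.
    have T_gt0 : 0 < T := T0.
    have comp (F : R -> R) b : {for t / alpha + b, continuous F} ->
        F (s / alpha + b) @[s --> t] --> F (t / alpha + b).
      by move=> cF; exact: (@cvg_comp R R R (fun s => s / alpha + b) F _ _ _
        (@cdiv b t) cF).
    have comp0 (F : R -> R) : {for t / alpha, continuous F} ->
        F (s / alpha) @[s --> t] --> F (t / alpha).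
      move=> cF; have := comp F 0; rewrite addr0 => /(_ cF).
      by under eq_fun do rewrite addr0.
    apply: cvgB; first by apply: comp0; exact: ck.
    apply: cvgM; first exact: cvg_cst.
    apply: cvgB; first by apply: comp0; apply: is_derive_continuous (dK _ _); lra.
    by apply: comp; apply: is_derive_continuous (dK _ _); lra.
  apply: subspace_eq_continuous => t; rewrite in_setE /from_subspace/= => t0.
  by have [_ ->] := KLP t t0.
by move=> t; apply: cvgM; [exact: crate|exact: cw].
Qed.

(** By the mean value theorem for [L] and then for [K], the exponent equals
    [alpha * (k c' * (r - c))] with [c] in the window, hence is at most [alpha * T * Q] in absolute
    value. *)
Lemma weight_bounds (t : R) : 0 <= t ->
  expR (- (alpha * T * Q)) <= weight t <= expR (alpha * T * Q).
Proof.
have [K [L [dK dL KLP]]] := weight_primitives.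
move=> t0; have [-> _] := KLP t t0.
have : 0 <= t / alpha by rewrite divr_ge0// ltW.
move: (t / alpha) => r r0; have T_gt0 : 0 < T := T0.
have mvt (F F' : R -> R) (a b : R) : - T <= a -> a <= b ->
    (forall x, - T <= x -> is_derive x 1 F (F' x)) ->
    exists2 c, a <= c <= b & F b - F a = F' c * (b - a).
  move=> Ta ab dF.
  have [||c cab E] := @MVT_segment R F F' a b ab.
  - by move=> x; rewrite in_itv/= => /andP[ax _]; apply: dF; lra.
  - apply/subspace_continuousP => x /=; rewrite in_itv/= => /andP[ax _].
    by apply: cvg_within_filter; apply: is_derive_continuous (dF x _); lra.
  by exists c => //; rewrite in_itv in cab.
have TrT : - T <= r - T by lra.
have rTr : r - T <= r by lra.
have [c /andP[Tc cr] LE] := mvt L K (r - T) r TrT rTr dL.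
have [c' _ KE] := mvt K k c r (le_trans TrT Tc) cr dK.
have -> : alpha / T * (T * K r - (L r - L (r - T))) = alpha * (k c' * (r - c)).
  by rewrite LE -KE; field; rewrite gt_eqF.
rewrite !ler_expR -mulrA -ler_norml normrM gtr0_norm// ler_pM2l//.
rewrite normrM mulrC ler_pM// ger0_norm; lra.
Qed.

End averaging.
End primitives.

(** * The slow parameter *)

Section slow_parameter.
Variables (R : realType) (n d : nat).
Variables (V : 'cV[R]_n -> R -> 'cV[R]_d -> R) (p : R -> 'cV[R]_d) (alpha : R).
Hypothesis V_C1 : C1_xttau V.
Hypothesis p_derivable : forall r : R, derivable p r 1.
Hypothesis p'_continuous : continuous (derive1 p).

Let U x t := V x t (p (t / alpha)).

Lemma slow_parameter_coord_tder t i :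
  tder (fun s => p (s / alpha) i 0) t ((alpha^-1 *: derive1 p (t / alpha)) i 0).
Proof.
apply: is_derive_tder; rewrite mxE.
have dp : is_derive (t / alpha) 1 (fun r => p r i 0) (derive1 p (t / alpha) i 0).
  have dpr : derivable p (t / alpha) 1 by exact: p_derivable.
  apply: DeriveDef; first by have /derivable_mxP := dpr; exact.
  by rewrite derive1E derive_mx// mxE.
have dp' : is_derive (alpha^-1 * t + 0) 1 (fun r => p r i 0) (derive1 p (t / alpha) i 0).
  by rewrite addr0 mulrC.
have := is_derive1_affine dp'.
by congr (is_derive _ _ _ _); apply/funext => s; rewrite addr0 mulrC.
Qed.

Lemma slow_parameter_tder x t : 0 <= t ->
  tder (U x) t (V_t V x t (p (t / alpha)) +
    dotv (V_tau V x t (p (t / alpha))) (alpha^-1 *: derive1 p (t / alpha))).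
Proof.
move=> t0; have := C1_chain_rule V_C1 (xi := fun=> x) (v := 0) t0 _
  (slow_parameter_coord_tder t).
rewrite [dotv _ 0]big1 ?add0r; last by move=> i _; rewrite [X in _ * X]mxE mulr0.
apply=> i; rewrite mxE => e e0.
apply: filterS (filterT : nbhs t setT) => s _ _ /=.
by rewrite mul0r !subrr normr0 mulr_ge0// ltW.
Qed.

(** The time derivative of [U] contains [p'] through the dependence on [tau], so its continuity
    rests on that of [derive1 p]. *)
Lemma C1_slow_parameter : C1_xt U.
Proof.
case: (V_C1) => dV cV cx ct ctau.
have cdiv : continuous (fun t : R => t / alpha).
  by move=> t; apply: cvgM; [exact: cvg_id|exact: cvg_cst].
have cp : continuous p.
  by move=> r; apply: differentiable_continuous; exact/derivable1_diffP.
have cpr : continuous (fun t : R => p (t / alpha)).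
  by move=> t; exact: (@cvg_comp _ _ _ _ p _ _ _ (@cdiv t) (@cp (t / alpha))).
have cp'r : continuous (fun t : R => alpha^-1 *: derive1 p (t / alpha)).
  move=> t; apply: cvgZ; first exact: cvg_cst.
  exact: (@cvg_comp _ _ _ _ (derive1 p) _ _ _ (@cdiv t)
    (@p'_continuous (t / alpha))).
have lift (S : topologicalType) (F : 'cV[R]_n * R * 'cV[R]_d -> S) :
    {within @dom_xtau R n d, continuous F} ->
    {within [set z : 'cV[R]_n * R | 0 <= z.2], continuous
      (fun z => F (z.1, z.2, p (z.2 / alpha)))}.
  move=> cF; apply: (@within_continuous_comp _ _ _ _ _ F
    (fun z : 'cV[R]_n * R => (z.1, z.2, p (z.2 / alpha))) cF) => //.
  apply: within_continuous_pair.
    apply: within_continuous_pair; apply: continuous_subspaceT => z.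
      exact: cvg_fst.
    exact: cvg_snd.
  apply: continuous_subspaceT => z.
  exact: (@cvg_comp _ _ _ (fun z : 'cV[R]_n * R => z.2)
    (fun t => p (t / alpha)) _ _ _ cvg_snd (@cpr z.2)).
split.
- move=> x t t0; have [dx _ _] := dV x t (p (t / alpha)) t0; split=> //.
  by have [] := tder_tderive t0 (slow_parameter_tder x t0).
- exact: lift cV.
- exact: lift cx.
- have : {within [set z : 'cV[R]_n * R | 0 <= z.2], continuous
      (fun z => V_t V z.1 z.2 (p (z.2 / alpha)) +
        dotv (V_tau V z.1 z.2 (p (z.2 / alpha)))
          (alpha^-1 *: derive1 p (z.2 / alpha)))}.
    have cb : {within [set z : 'cV[R]_n * R | 0 <= z.2], continuous
        (fun z => alpha^-1 *: derive1 p (z.2 / alpha))}.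
      apply: continuous_subspaceT => y.
      exact: (@cvg_comp _ _ _ (fun z : 'cV[R]_n * R => z.2)
        (fun t => alpha^-1 *: derive1 p (t / alpha)) _ _ _ cvg_snd (@cp'r y.2)).
    move=> z; apply: cvgD; first exact: (lift _ _ ct z).
    exact: (dotv_continuous (lift _ _ ctau z) (cb z)).
  apply: subspace_eq_continuous => z; rewrite in_setE /from_subspace/= => z0.
  by have [_ ->] := tder_tderive z0 (slow_parameter_tder z.1 z0).
Qed.

End slow_parameter.

(** * Decay of the weighted function and the resulting stability *)

Lemma powR_inv4 (R : realType) (a : R) : 0 <= a ->
  a `^ (4%:R)^-1 = Num.sqrt (Num.sqrt a).
Proof.
move=> a0; rewrite -!powR12_sqrt ?powR_ge0// -powRrM.
by congr (_ `^ _); field.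
Qed.

Theorem theorem22 (R : realType) (n m d : nat)
    (f : 'cV[R]_n -> R -> 'cV[R]_d -> 'cV[R]_n)
    (g : 'cV[R]_n -> R -> 'cV[R]_d -> 'M[R]_(n, m))
    (p : R -> 'cV[R]_d)
    (f_lip : [locally [lipschitz f z.1.1 z.1.2 z.2 | z in @dom_xtau R n d]])
    (g_lip : [locally [lipschitz g z.1.1 z.1.2 z.2 | z in @dom_xtau R n d]])
    (fg_growth : exists2 alpha4 : R -> R, Kinf alpha4 &
       forall (x : 'cV[R]_n) (t alpha : R), 0 <= t -> 0 < alpha ->
         enorm (f x t (p (t / alpha))) + opnorm (g x t (p (t / alpha)))
           <= alpha4 (enorm x))
    (p_bounded : exists M : R, forall r, enorm (p r) <= M)
    (p_derivable : forall r : R, derivable p r 1)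
    (p'_continuous : continuous (derive1 p))
    (p'_bounded : exists M : R, forall r, enorm (derive1 p r) <= M)
    (complete : forall alpha : R, 0 < alpha ->
       forward_complete (fun x t => f x t (p (t / alpha)))
                        (fun x t => g x t (p (t / alpha))))
    (alpha1 alpha2 : R -> R) (c_a c_b T : R) (q : 'cV[R]_d -> R)
    (V : 'cV[R]_n -> R -> 'cV[R]_d -> R)
    (alpha1_Kinf : Kinf alpha1) (alpha2_Kinf : Kinf alpha2)
    (c_a_gt0 : 0 < c_a) (c_b_gt0 : 0 < c_b) (T_gt0 : 0 < T)
    (q_continuous : continuous q)
    (V_C1 : C1_xttau V)
    (V_ge0 : forall x t tau, 0 <= t -> 0 <= V x t tau)
    (V_bounds : forall x t tau, 0 <= t -> range p tau ->
       alpha1 (enorm x) <= V x t tau <= alpha2 (enorm x))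
    (V_decay : forall x t tau, 0 <= t -> range p tau ->
       V_t V x t tau + dotv (V_x V x t tau) (f x t tau) <= - q tau * V x t tau)
    (V_tau_bound : forall x t tau, 0 <= t -> range p tau ->
       enorm (V_tau V x t tau) <= c_a * V x t tau)
    (q_average : forall t : R, 0 <= t ->
       c_b <= \int[lebesgue_measure]_(s in `[t - T, t]) q (p s))
    (V_x_bound : forall (x : 'cV[R]_n) (t alpha : R), 0 <= t -> 0 < alpha ->
       enorm (V_x V x t (p (t / alpha))) <= c_a * Num.sqrt (alpha1 (enorm x)))
    (g_bound : forall (x : 'cV[R]_n) (t alpha : R), 0 <= t -> 0 < alpha ->
       opnorm (g x t (p (t / alpha)))
         <= c_a * (1 + alpha1 (enorm x) `^ (4%:R)^-1)) :
  forall alpha : R, 0 < alpha ->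
    4%:R * T * c_a * sup (range (fun r => enorm (derive1 p r))) / c_b < alpha ->
    ISS (fun x t => f x t (p (t / alpha))) (fun x t => g x t (p (t / alpha))) /\
    ISS_Lyapunov (fun x t => f x t (p (t / alpha)))
                 (fun x t => g x t (p (t / alpha)))
                 (Vsharp alpha T q p V).
Proof.
move=> alpha alpha_gt0 alpha_large.
set pbar := sup _ in alpha_large.
have pbarP r : enorm (derive1 p r) <= pbar.
  apply: ub_le_sup; last by exists r.
  by have [M pM] := p'_bounded; exists M => _ [s _ <-].
pose k r := q (p r).
have ck : continuous k.
  move=> r; have cp : {for r, continuous p}.
    by apply: differentiable_continuous; exact/derivable1_diffP.
  exact: (@cvg_comp _ _ _ p q _ _ _ cp (@q_continuous (p r))).
have [Q kQ] : exists Q, forall r, `|k r| <= Q.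
  have [M pM] := p_bounded; have [B qB] := continuous_bounded_cV M q_continuous.
  by exists B => r; exact: qB.
pose E := weight k T alpha.
pose rate := weight_rate k T alpha.
have dE t : 0 <= t -> tder E t (rate t * E t) by move=> t0; exact: weight_tder.
have E_bounds t : 0 <= t -> expR (- (alpha * T * Q)) <= E t <= expR (alpha * T * Q).
  by move=> t0; exact: weight_bounds.
have E_gt0 t : 0 < E t by exact: expR_gt0.
pose U x t := V x t (p (t / alpha)).
have U_C1 : C1_xt U := C1_slow_parameter alpha V_C1 p_derivable p'_continuous.
have VE : Vsharp alpha T q p V = (fun x t => E t * U x t) by [].
have W_C1 : C1_xt (fun x t => E t * U x t).
  by apply: (C1_time_weight dE) => //; exact: weight_rate_continuous.
have a1_ge0 (x : 'cV[R]_n) : 0 <= alpha1 (enorm x).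
  by apply: Kinf_ge0 => //; exact: enorm_ge0.
have U_bounds x t : 0 <= t -> alpha1 (enorm x) <= U x t <= alpha2 (enorm x).
  by move=> t0; apply: V_bounds => //; exists (t / alpha).
have U_ge0 x t : 0 <= t -> 0 <= U x t by move=> t0; exact: V_ge0.
pose c := c_b / (4 * T * c_a ^+ 2).
have c_gt0 : 0 < c by rewrite divr_gt0// !mulr_gt0// exprn_gt0.
pose kappa (s : R) := s ^+ 2 / (1 + s).
pose chi (s : R) := c * kappa (Num.sqrt (Num.sqrt (alpha1 s))).
have chi_Kinf : Kinf chi.
  apply: KinfZ => //; apply: (@Kinf_comp _ kappa); first exact: Kinf_sqr_div.
  apply: (@Kinf_comp _ Num.sqrt); first exact: Kinf_sqrt.
  by apply: Kinf_comp => //; exact: Kinf_sqrt.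
pose lam := c_b / (2 * T).
have lam_gt0 : 0 < lam by rewrite divr_gt0// mulr_gt0.
(* The lower bound on [alpha] enters only here: it caps the drift caused by the moving parameter at
   a quarter of the average rate [c_b / T]. *)
have slow : c_a * pbar / alpha <= c_b / (4 * T).
  rewrite ler_pdivrMr// mulrAC ler_pdivlMr ?mulr_gt0// mulrC.
  by move: alpha_large; rewrite ltr_pdivrMr// => /ltW; rewrite [alpha * _]mulrC; lra.
have decay x t u : 0 <= t -> enorm u <= chi (enorm x) ->
    tderive (fun s => E s * U x s) t +
      dotv (grad (fun y => E t * U y t) x)
        (f x t (p (t / alpha)) + g x t (p (t / alpha)) *m u)
    <= - lam * (E t * U x t).
  move=> t0 u_chi.
  have r0 : 0 <= t / alpha by rewrite divr_ge0// ltW.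
  have ran : range p (p (t / alpha)) by exists (t / alpha).
  rewrite (tderive_time_weight dE U_C1 x t0) (grad_time_weight E U_C1 x t0) dotvZl.
  have [_ ->] := tder_tderive t0
    (slow_parameter_tder alpha V_C1 p_derivable x t0).
  have Vx_E : grad (U^~ t) x = V_x V x t (p (t / alpha)) by [].
  rewrite Vx_E dotvDr dotvZr.
  move: (V_decay x t _ t0 ran) (V_tau_bound x t _ t0 ran) (V_x_bound x t _ t0 alpha_gt0)
    (g_bound x t _ t0 alpha_gt0) (U_bounds x t t0) (q_average _ r0).
  rewrite -/(U x t) -/(k (t / alpha)) => Vdec Vtau Vxb gb /andP[a1U _] qavg.
  set vt := V_t _ _ _ _ in Vdec *; set vxf := dotv _ (f _ _ _) in Vdec *.
  (* The term [k (t / alpha)] will cancel against [- q] in [Vdec], leaving the window average,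
     estimated at the time [t / alpha >= 0]. *)
  have rate_le : rate t <= k (t / alpha) - c_b / T.
    by rewrite lerD2l lerN2 mulrC ler_pM2l// invr_gt0.
  have tau_le : alpha^-1 * dotv (V_tau V x t (p (t / alpha))) (derive1 p (t / alpha))
      <= c_b / (4 * T) * U x t.
    have le1 : dotv (V_tau V x t (p (t / alpha))) (derive1 p (t / alpha)) <=
        c_a * U x t * pbar.
      by apply: le_trans (dotv_le _ _) _; apply: ler_pM; rewrite ?enorm_ge0.
    have ai0 : 0 <= alpha^-1 by rewrite invr_ge0 ltW.
    apply: le_trans (ler_wpM2l ai0 le1) _.
    have -> : alpha^-1 * (c_a * U x t * pbar) = c_a * pbar / alpha * U x t by ring.
    by rewrite ler_wpM2r// U_ge0.
  have gu_le : dotv (V_x V x t (p (t / alpha))) (g x t (p (t / alpha)) *m u)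
      <= c_b / (4 * T) * U x t.
    apply: le_trans (dotv_le _ _) _.
    have gu : enorm (g x t (p (t / alpha)) *m u) <=
        c_a * (1 + alpha1 (enorm x) `^ (4%:R)^-1) * chi (enorm x).
      apply: le_trans (enorm_mulmx_le _ _) _.
      apply: le_trans (ler_wpM2r (enorm_ge0 _) gb) _.
      by rewrite ler_wpM2l// mulr_ge0 ?(ltW c_a_gt0)// addr_ge0// powR_ge0.
    apply: le_trans (ler_pM (enorm_ge0 _) (enorm_ge0 _) Vxb gu) _.
    rewrite powR_inv4// /chi /kappa; set y := Num.sqrt (Num.sqrt _).
    have y0 : 0 <= y by exact: sqrtr_ge0.
    have y2 : Num.sqrt (alpha1 (enorm x)) = y ^+ 2.
      by rewrite sqr_sqrtr// sqrtr_ge0.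
    have y4 : alpha1 (enorm x) = y ^+ 4.
      by rewrite -[LHS]sqr_sqrtr// y2 -exprM.
    (* The factor [1 + y] from the bound on [g] cancels the denominator of [kappa], and [c] absorbs
       [c_a ^+ 2]. *)
    have -> : c_a * Num.sqrt (alpha1 (enorm x)) *
        (c_a * (1 + y) * (c * (y ^+ 2 / (1 + y)))) = c_b / (4 * T) * y ^+ 4.
      have y1 : 1 + y != 0 by rewrite gt_eqF// ltr_wpDr.
      by rewrite y2 /c; field; rewrite y1 !gt_eqF.
    by rewrite -y4 ler_wpM2l// divr_ge0 ?(ltW c_b_gt0)// mulr_ge0// ltW.
  have rate_U : rate t * U x t <= (k (t / alpha) - c_b / T) * U x t.
    by rewrite ler_wpM2r// U_ge0.
  have lamE : - lam * (E t * U x t) = E t * (- (c_b / T) * U x t +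
      c_b / (4 * T) * U x t + c_b / (4 * T) * U x t).
    by rewrite /lam; field; rewrite gt_eqF.
  rewrite lamE -/(U x t).
  have -> : rate t * E t * U x t = E t * (rate t * U x t) by ring.
  rewrite -!mulrDr ler_pM2l//.
  by move: rate_U Vdec tau_le gu_le; rewrite -/vt -/vxf; lra.
have W_bounds x t : 0 <= t ->
    expR (- (alpha * T * Q)) * alpha1 (enorm x) <= E t * U x t <=
    expR (alpha * T * Q) * alpha2 (enorm x).
  move=> t0; have /andP[E1 E2] := E_bounds t t0.
  have /andP[U1 U2] := U_bounds x t t0.
  by rewrite !ler_pM ?expR_ge0// ?U_ge0// ltW.
have K1 : Kinf (fun s => expR (- (alpha * T * Q)) * alpha1 s).
  by apply: KinfZ => //; exact: expR_gt0.
have K2 : Kinf (fun s => expR (alpha * T * Q) * alpha2 s).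
  by apply: KinfZ => //; exact: expR_gt0.
rewrite VE; split.
  exact: (@exp_Lyapunov_ISS _ _ _ _ _ _ _ _ _ _ (complete _ alpha_gt0) W_C1 lam_gt0
    K1 K2 chi_Kinf W_bounds decay).
split=> // [x t t0|]; first by rewrite mulr_ge0 ?U_ge0// ltW.
(* Decay must be expressed through [|x|]: the lower bound on [Vsharp] converts the rate
   [- lam * Vsharp] into a negative multiple of [alpha1]. *)
exists (fun s => expR (- (alpha * T * Q)) * alpha1 s),
  (fun s => expR (alpha * T * Q) * alpha2 s), chi,
  (fun s => lam * (expR (- (alpha * T * Q)) * alpha1 s)).
split=> //; first by apply/Kinf_posdef/KinfZ.
move=> x t u t0; split; first exact: W_bounds.
move=> /(decay _ _ _ t0) /le_trans; apply.
rewrite mulNr lerN2 ler_pM2l//.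
by case/andP: (W_bounds x t t0).
Qed.
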